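(* Let $K\subset\mathbb{R}^n$ be a convex body that is $0$-symmetric (i.e. $K=-K$) and in John position. Then $$\mathcal{W}(K)\leq\mathcal{W}\bigl([-1,1]^n\bigr),$$ where $\mathcal{W}$ is the Wills functional.
   Context: A convex body in $\mathbb{R}^n$ is a non-empty compact convex set; $\mathrm{vol}$ is $n$-dimensional Lebesgue measure. A convex body $K$ is in John position if the maximum volume ellipsoid contained in $K$ is the Euclidean unit ball $B_2^n$. With $\kappa_j=\mathrm{vol}_j(B_2^j)=\pi^{j/2}/\Gamma(j/2+1)$, the intrinsic volumes $\mathrm{V}_i(K)$, $0\le i\le n$, of a convex body $K$ are defined by the Steiner formula $\mathrm{vol}(K+\lambda B_2^n)=\sum_{i=0}^n\kappa_{n-i}\mathrm{V}_i(K)\lambda^{n-i}$ for all $\lambda\geq 0$. The Wills functional is $\mathcal{W}(K)=\sum_{i=0}^n\mathrm{V}_i(K)$; equivalently, $\mathcal{W}(K)=\int_{\mathbb{R}^n}e^{-\pi d(x,K)^2}\,dx$, where $d(x,K)$ is the Euclidean distance from $x$ to $K$. *)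

(* Defs.v *)
From HB Require Import structures.
From mathcomp Require Import all_boot all_order all_algebra.
From mathcomp Require Import all_classical all_reals all_analysis.

Set Implicit Arguments.
Unset Strict Implicit.
Unset Printing Implicit Defensive.
Import Order.TTheory GRing.Theory Num.Theory.
Import numFieldNormedType.Exports.

Local Open Scope classical_set_scope.
Local Open Scope ring_scope.

(* n-dimensional Lebesgue measure as the n-fold product of the one-dimensional
   one: [vol n.+1 A] is [(lebesgue_measure \x vol n) A] written out, i.e. the
   integral of the measures of the sections of A.  It is meant for Borel sets
   (below, it is only applied to compact sets). *)
Fixpoint vol (R : realType) (n : nat) : set 'rV[R]_n -> \bar R :=
  match n with
  | 0 => fun A => (\1_A 0)%:E
  | m.+1 => fun A =>
      (\int[lebesgue_measure]_(t in [set: R])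
         @vol R m [set y : 'rV[R]_m | A (row_mx t%:M y : 'rV[R]_(1 + m))])%E
  end.

(* The norm [`|x|] that MathComp-Analysis puts on ['rV_n] is the sup norm; it
   induces the usual topology, but is not the Euclidean norm. *)
Definition enorm (R : realType) (n : nat) (x : 'rV[R]_n) : R :=
  Num.sqrt (\sum_(i < n) x ord0 i ^+ 2).

Definition unit_ball (R : realType) (n : nat) : set 'rV[R]_n :=
  [set x | enorm x <= 1].
Arguments unit_ball : clear implicits.

Definition cube (R : realType) (n : nat) : set 'rV[R]_n :=
  [set x | forall i, -1 <= x ord0 i <= 1].
Arguments cube : clear implicits.

Definition convex_body (R : realType) (n : nat) (K : set 'rV[R]_n) : Prop :=
  [/\ K !=set0, compact K & convex_set (K : set (convex_lmodType 'rV[R]_n))].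

Definition symmetric_body (R : realType) (n : nat) (K : set 'rV[R]_n) : Prop :=
  K = [set - x | x in K].

Definition ellipsoid (R : realType) (n : nat) (E : set 'rV[R]_n) : Prop :=
  exists (c : 'rV[R]_n) (A : 'M[R]_n),
    A \in unitmx /\ E = [set c + x *m A | x in unit_ball R n].

(* A maximum volume ellipsoid of a convex body is unique, so "the" maximum
   volume ellipsoid is any volume maximizer. *)
Definition max_volume_ellipsoid (R : realType) (n : nat)
    (K E : set 'rV[R]_n) : Prop :=
  [/\ ellipsoid E, E `<=` K &
      forall F, ellipsoid F -> F `<=` K -> (vol F <= vol E)%E].

Definition john_position (R : realType) (n : nat) (K : set 'rV[R]_n) : Prop :=
  max_volume_ellipsoid K (unit_ball R n).

Definition parallel_body (R : realType) (n : nat) (K : set 'rV[R]_n) (l : R) :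
    set 'rV[R]_n :=
  [set x + l *: y | x in K & y in unit_ball R n].

Definition kappa (R : realType) (j : nat) : R := fine (vol (unit_ball R j)).

Definition steiner_formula (R : realType) (n : nat) (K : set 'rV[R]_n)
    (V : 'I_n.+1 -> R) : Prop :=
  forall l : R, 0 <= l ->
    vol (parallel_body K l) =
    (\sum_(i < n.+1) kappa R (n - i) * V i * l ^+ (n - i))%:E.

(* For a convex body, the family satisfying the Steiner formula exists and is
   unique, as the coefficients of a polynomial; [xget] selects it, its default
   value [cst 0] being irrelevant in that case. *)
Definition intrinsic_volume (R : realType) (n : nat) (K : set 'rV[R]_n) :
    'I_n.+1 -> R :=
  xget (cst 0) [set V | steiner_formula K V].

Definition wills (R : realType) (n : nat) (K : set 'rV[R]_n) : R :=
  \sum_(i < n.+1) intrinsic_volume K i.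

(* Main.v *)
(* Integrating the Steiner formula against the density [2 pi l exp (- pi l^2)]
   turns [W(K)] into the integral of [exp (- pi d(x, K)^2)], and [W([-1, 1]^n)] into
   [3^n].  In John position, contact points [u_i] and weights [c_i] satisfy
   [sum c_i u_i (x) u_i = id].  By symmetry [K] lies in the slabs [|<x, u_i>| <= 1],
   so [d(x, K)^2 >= sum c_i d(<x, u_i>, [-1, 1])^2], and it remains to bound the
   integral of [prod f(<x, u_i>)^c_i], with [f t = exp (- pi d(t, [-1, 1])^2)] of
   mass [3], by [3^n].  This is the geometric Brascamp-Lieb inequality, proved by
   Barthe's transport: if [T] transports [f / 3] to the Gaussian density, the
   Jacobian of [x |-> sum c_i T(<x, u_i>) u_i] dominates the product. *)
From HB Require Import structures.
Require Import Defs.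
From mathcomp Require Import all_boot all_order all_algebra.
From mathcomp Require Import all_classical all_reals all_analysis.
From mathcomp Require Import measurable_realfun gauss_integral.
From mathcomp Require Import ring lra.
From mathcomp Require complex spectral.
Set Implicit Arguments.
Unset Strict Implicit.
Unset Printing Implicit Defensive.
Import Order.TTheory GRing.Theory Num.Theory.
Import numFieldNormedType.Exports.
Local Open Scope classical_set_scope.
Local Open Scope ring_scope.

(** * Lebesgue measure on row vectors *)

(** Barthe's transport is wanted only as an inequality between two integrals. It is obtained by
    bisecting cubes in the target space, from two properties of the map [Theta]: differentiability
    at every point, and an expansion bound $|x-y|\le L\,|\Theta x-\Theta y|$. The expansion bound
    comes from $T'\ge 1/3$, which says that $f(t)\ge e^{-\pi T(t)^2}$. The Jacobian bound is
    Jensen's inequality for the exponential, applied in an eigenbasis of the Jacobian. The contact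
    points come from projecting the identity matrix on the cone spanned by the matrices $v^Tv$, with
    $v$ a multiple of a contact point; a nonzero residual would yield an ellipsoid in $K$ larger
    than the ball. The mass $3$ of $f$ is $2+1$: the length of $[-1,1]$, where $f=1$, plus the
    Gaussian mass of the two tails. The comparison itself takes place on the sublevel sets $\{q\le
    l^2\}$ of $q(x)=\sum c_i\,d(\langle x,u_i\rangle,[-1,1])^2$, which contain the parallel bodies
    $K+lB$. *)

Definition rv_display : measure_display. Proof. exact: default_measure_display. Qed.

Section rv_measurable.
Context (R : realType) (n : nat).

Let coor (i : 'I_n) (x : 'rV[R]_n) : measurableTypeR R := x ord0 i.

Let rv_set0 : g_sigma_preimage coor set0.
Proof. exact: sigma_algebra0. Qed.

Let rv_setC A : g_sigma_preimage coor A -> g_sigma_preimage coor (~` A).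
Proof. exact: sigma_algebraC. Qed.

Let rv_bigcup (F : _^nat) : (forall i, g_sigma_preimage coor (F i)) ->
  g_sigma_preimage coor (\bigcup_i (F i)).
Proof. exact: sigma_algebra_bigcup. Qed.

(** The sigma-algebra is the one generated by the coordinates, so that a map into row vectors is
    measurable as soon as its coordinates are. *)
HB.instance Definition _ := @isMeasurable.Build rv_display
  'rV[R]_n (g_sigma_preimage coor) rv_set0 rv_setC rv_bigcup.

Lemma measurable_coor (i : 'I_n) :
  measurable_fun [set: 'rV[R]_n] (fun x => x ord0 i).
Proof.
move=> _ Y mY; rewrite setTI; apply: sub_sigma_algebra => /=.
rewrite -bigcup_seq/=; exists i => /=; first by rewrite mem_index_enum.
by exists Y => //; rewrite setTI.
Qed.

Lemma measurable_fun_rv d (T : measurableType d) (f : T -> 'rV[R]_n) :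
  (forall i, measurable_fun [set: T] (fun t => f t ord0 i)) ->
  measurable_fun [set: T] f.
Proof.
move=> mf.
suff : g_sigma_preimage (fun i => coor i \o f) `<=` measurable.
  rewrite g_sigma_preimage_comp => prefS _ A mA.
  by apply: prefS; exists A.
apply: smallest_sub; first exact: sigma_algebra_measurable.
move=> A; rewrite -bigcup_seq => -[i /= _ [B mB <-]]; exact: mf.
Qed.

End rv_measurable.

(** Written with [row_mx] as in [vol], so that both definitions take literally the same sections of
    a set. *)
Definition rcons0 (R : realType) n (p : measurableTypeR R * 'rV[R]_n) : 'rV[R]_n.+1 :=
  row_mx p.1%:M p.2 : 'rV[R]_(1 + n).

Section consrv.
Context (R : realType) (n : nat).

Lemma rcons0_0 (p : R * 'rV[R]_n) : rcons0 p ord0 ord0 = p.1.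
Proof.
rewrite /rcons0 (_ : (ord0 : 'I_n.+1) = lshift n (ord0 : 'I_1)); last exact/val_inj.
by rewrite [LHS](@row_mxEl _ _ 1 n) mxE eqxx mulr1n.
Qed.

Lemma rcons0_S (p : R * 'rV[R]_n) i : rcons0 p ord0 (lift ord0 i) = p.2 ord0 i.
Proof.
rewrite /rcons0 (_ : lift ord0 i = rshift 1 i); last exact/val_inj.
by rewrite [LHS](@row_mxEr _ _ 1 n).
Qed.

Lemma measurable_rcons0 : measurable_fun setT (@rcons0 R n).
Proof.
apply: measurable_fun_rv => i; case: (unliftP ord0 i) => [j ->|->].
  under eq_fun do rewrite rcons0_S.
  by apply: (measurableT_comp (@measurable_coor R n j)); exact: measurable_snd.
under eq_fun do rewrite rcons0_0.
exact: measurable_fst.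
Qed.

Definition rsplit0 (x : 'rV[R]_n.+1) : measurableTypeR R * 'rV[R]_n :=
  (x ord0 ord0, \row_j x ord0 (lift ord0 j)).

Lemma rcons0K : cancel (@rcons0 R n) rsplit0.
Proof.
move=> [t y]; rewrite /rsplit0 rcons0_0; congr pair.
by apply/rowP => j; rewrite mxE rcons0_S.
Qed.

Lemma rsplit0K : cancel rsplit0 (@rcons0 R n).
Proof.
move=> x; apply/rowP => i; case: (unliftP ord0 i) => [j ->|->].
  by rewrite rcons0_S /= mxE.
by rewrite rcons0_0.
Qed.

Lemma measurable_rsplit0 : measurable_fun setT rsplit0.
Proof.
apply/measurable_fun_pairP; split; first exact: measurable_coor.
apply: measurable_fun_rv => i /=.
under eq_fun do rewrite mxE.
exact: measurable_coor.
Qed.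

End consrv.

Section cons_measure.
Context (R : realType) (n : nat).
Variable m : {sigma_finite_measure set 'rV[R]_n -> \bar R}.

Definition cons_measure : set 'rV[R]_n.+1 -> \bar R :=
  pushforward (lebesgue_measure \x m)%E (@rcons0 R n).

Let cons_measure0 : cons_measure set0 = 0%E.
Proof. by rewrite /cons_measure /pushforward preimage_set0 measure0. Qed.

Let cons_measure_ge0 A : (0 <= cons_measure A)%E.
Proof. by rewrite /cons_measure /pushforward; exact: measure_ge0. Qed.

Let cons_measure_sigma_additive : semi_sigma_additive cons_measure.
Proof.
have mf (A : set 'rV[R]_n.+1) : measurable A -> measurable (@rcons0 R n @^-1` A).
  by move=> mA; rewrite -[X in measurable X]setTI; exact: measurable_rcons0.
move=> F mF tF mUF; rewrite /cons_measure /pushforward preimage_bigcup.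
apply: measure_semi_sigma_additive.
- by move=> k; exact: mf.
- apply/trivIsetP => /= i j _ _ ij; rewrite -preimage_setI.
  by move/trivIsetP : tF => /(_ _ _ _ _ ij) ->//; rewrite preimage_set0.
- by rewrite -preimage_bigcup; exact: mf.
Qed.

HB.instance Definition _ := isMeasure.Build _ _ _ cons_measure
  cons_measure0 cons_measure_ge0 cons_measure_sigma_additive.

Let cons_measure_sigma_finite : sigma_finite setT cons_measure.
Proof.
have /sigma_finiteP[F [TF ndF Foo]] :=
  sigma_finiteT (@lebesgue_measure R : {sigma_finite_measure set _ -> \bar R}).
have /sigma_finiteP[G [TG ndG Goo]] := sigma_finiteT m.
exists (fun k => @rsplit0 R n @^-1` (F k `*` G k)).
  apply/seteqP; split => // x _.
  have : setT (rsplit0 x).1 by [].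
  have : setT (rsplit0 x).2 by [].
  rewrite {1}TG TF => -[k _ Gk] [j _ Fj]; exists (maxn k j) => //; split.
    by apply: subsetPset Fj; apply: ndF; exact: leq_maxr.
  by apply: subsetPset Gk; apply: ndG; exact: leq_maxl.
move=> k; have [? ?] := Foo k; have [? ?] := Goo k.
have mFG : measurable (F k `*` G k) by exact: measurableX.
split; first by rewrite -[X in measurable X]setTI; exact: measurable_rsplit0.
rewrite /cons_measure /pushforward -comp_preimage.
rewrite (_ : _ \o _ = id) /=; last by apply/funext => x /=; rewrite rcons0K.
by rewrite preimage_id product_measure1E// lte_mul_pinfty// ge0_fin_numE.
Qed.

HB.instance Definition _ := Measure_isSigmaFinite.Build _ _ _ cons_measure
  cons_measure_sigma_finite.

End cons_measure.

(** Sigma-finiteness is carried through the recursion because Tonelli's theorem in the next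
    dimension asks for it. *)
Fixpoint leb (R : realType) n : {sigma_finite_measure set 'rV[R]_n -> \bar R} :=
  match n with
  | 0 => dirac (0 : 'rV[R]_0)
  | m.+1 => cons_measure (leb R m)
  end.

Section leb_theory.
Context (R : realType).
Local Notation mu := (@lebesgue_measure R).

Lemma leb0_integral (f : 'rV[R]_0 -> \bar R) : (forall x, 0 <= f x)%E ->
  (\int[leb R 0]_x f x = f 0%R)%E.
Proof.
move=> f0 /=; rewrite integral_dirac//=.
  by rewrite diracT mul1e.
move=> _ Y mY; rewrite setTI.
have [fY|fY] := pselect (Y (f 0)).
  rewrite (_ : f @^-1` Y = setT) //; apply/seteqP; split => // x _ /=.
  by rewrite (_ : x = 0) //; apply/rowP; case.
rewrite (_ : f @^-1` Y = set0) //; apply/seteqP; split => // x /=.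
by rewrite (_ : x = 0) //; apply/rowP; case.
Qed.

Lemma lebS_integral n (f : 'rV[R]_n.+1 -> \bar R) : measurable_fun setT f ->
  (forall x, 0 <= f x)%E ->
  (\int[leb R n.+1]_x f x = \int[mu]_t \int[leb R n]_y f (rcons0 (t, y)))%E.
Proof.
move=> mf f0; rewrite /=.
rewrite ge0_integral_pushforward//=; last exact: measurable_rcons0.
rewrite preimage_setT fubini_tonelli1//=.
exact: (measurableT_comp mf (@measurable_rcons0 R n)).
Qed.

Lemma lebS_integral' n (f : 'rV[R]_n.+1 -> \bar R) : measurable_fun setT f ->
  (forall x, 0 <= f x)%E ->
  (\int[leb R n.+1]_x f x = \int[leb R n]_y \int[mu]_t f (rcons0 (t, y)))%E.
Proof.
move=> mf f0; rewrite lebS_integral//.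
rewrite (@fubini_tonelli _ _ _ _ _ mu (leb R n) (fun p => f (rcons0 p)))//.
exact: (measurableT_comp mf (@measurable_rcons0 R n)).
Qed.

Lemma measurable_lebS n (f : 'rV[R]_n.+1 -> \bar R) : measurable_fun setT f ->
  (forall x, 0 <= f x)%E ->
  measurable_fun setT (fun t : R => \int[leb R n]_y f (rcons0 (t, y)))%E.
Proof.
move=> mf f0.
apply: (@measurable_fun_fubini_tonelli_F _ _ _ _ _ (leb R n) (fun p => f (rcons0 p))) => //.
exact: (measurableT_comp mf (@measurable_rcons0 R n)).
Qed.

Lemma lebSE n (A : set 'rV[R]_n.+1) :
  leb R n.+1 A = (\int[mu]_t leb R n [set y | A (rcons0 (t, y))])%E.
Proof.
rewrite /= /cons_measure /pushforward /product_measure1/=.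
apply: eq_integral => t _ /=; congr (leb R n _).
by apply/seteqP; split => y /=; rewrite /xsection /= inE.
Qed.

(** Unfolding the product measure gives the same iterated integral of sections on both sides, whence
    the equality on arbitrary sets. *)
Lemma volE n (A : set 'rV[R]_n) : vol A = leb R n A.
Proof.
elim: n A => [A|n IH A]; first by rewrite /= diracE indicE.
by rewrite lebSE /=; apply: eq_integral => t _; rewrite IH.
Qed.

(** Simple functions below [f] are also below [g]. This covers integrands whose measurability is not
    established, such as the volumes of the sections of an arbitrary set. *)
Lemma ge0_subset_integralT (f g : R -> \bar R) : (forall x, 0 <= f x)%E ->
  (forall x, f x <= g x)%E -> (\int[mu]_x f x <= \int[mu]_x g x)%E.
Proof.
move=> f0 fg; have g0 x : (0 <= g x)%E by exact: le_trans (fg x).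
rewrite !ge0_integralTE//; apply: ereal_sup_le => _ [h hf <-].
by exists h => // x; exact: le_trans (hf x) (fg x).
Qed.

Lemma vol_ge0 n (A : set 'rV[R]_n) : (0 <= vol A)%E.
Proof. by rewrite volE. Qed.

(* The integral of a nonnegative function is a supremum over simple functions
   below it, so [vol] is monotone on arbitrary sets. *)
Lemma le_vol n (A B : set 'rV[R]_n) : A `<=` B -> (vol A <= vol B)%E.
Proof.
elim: n A B => [A B AB|n IH A B AB] /=.
  rewrite lee_fin !indicE; case: (boolP (0 \in A)) => // /set_mem/AB B0.
  by rewrite mem_set.
apply: ge0_subset_integralT => t; first exact: vol_ge0.
by apply: IH => y /AB.
Qed.

End leb_theory.

(** * Lebesgue measure under affine maps *)

Section lebesgue_affine.
Context (R : realType).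
Local Notation mu := (@lebesgue_measure R).

(** Uniqueness of Lebesgue measure: the rescaled pushforward gives half-open intervals their length.
    For negative [a] the preimage is closed at the other end, with the same length. *)
Lemma lebesgue_affine_preimage (a b : R) (A : set R) : a != 0 -> measurable A ->
  (mu A = `|a|%:E * mu ((fun t => a * t + b)%R @^-1` A))%E.
Proof.
move=> a0 mA.
pose phi (t : measurableTypeR R) : measurableTypeR R := a * t + b.
have mphi : measurable_fun setT phi.
  by apply: measurable_funD => //; exact: measurable_funM.
have a_gt0 : 0 < `|a| by rewrite normr_gt0.
pose nu : {measure set (measurableTypeR R) -> \bar R} :=
  mscale (NngNum (normr_ge0 a))
   (@measure_function_pushforward__canonical__measure_function_Measure _ _ _ _ _
    mu _ mphi).
transitivity (nu A) => //.
apply: lebesgue_measure_unique => // X /ocitvP[->|[[x y] /= xy ->]].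
  by rewrite !measure0.
rewrite /nu /mscale/= /pushforward lebesgue_measure_itv/= lte_fin xy.
have [a_lt0|ap|/eqP] := ltgtP a 0; last by rewrite (negbTE a0).
- rewrite (_ : _ @^-1` _ = `[(y - b) / a, (x - b) / a[%classic); last first.
    apply/seteqP; split => t; rewrite /phi/= !in_itv/=.
      by move=> /andP[h1 h2]; rewrite ler_ndivrMr// ltr_ndivlMr//; apply/andP; split; lra.
    by rewrite ler_ndivrMr// ltr_ndivlMr// => /andP[h1 h2]; apply/andP; split; lra.
  rewrite lebesgue_measure_itv/= lte_fin ltr_ndivrMr// divfK// ltrD2r xy.
  rewrite -!EFinB -EFinM; congr EFin; rewrite ltr0_norm//; field.
  exact: a0.
- rewrite (_ : _ @^-1` _ = `](x - b) / a, (y - b) / a]%classic); last first.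
    apply/seteqP; split => t; rewrite /phi/= !in_itv/=.
      by move=> /andP[h1 h2]; rewrite ler_pdivlMr// ltr_pdivrMr//; apply/andP; split; lra.
    by rewrite ler_pdivlMr// ltr_pdivrMr// => /andP[h1 h2]; apply/andP; split; lra.
  rewrite lebesgue_measure_itv/= lte_fin ltr_pdivrMr// divfK// ltrD2r xy.
  rewrite -!EFinB -EFinM; congr EFin; rewrite gtr0_norm//; field.
  exact: a0.
Qed.

Lemma integral_lebesgue_affine (a b : R) (f : R -> \bar R) : a != 0 ->
  measurable_fun setT f -> (forall x, 0 <= f x)%E ->
  (`|a|%:E * \int[mu]_t f (a * t + b)%R = \int[mu]_t f t)%E.
Proof.
move=> a0 mf f0.
pose phi (t : measurableTypeR R) : measurableTypeR R := a * t + b.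
have mphi : measurable_fun setT phi.
  by apply: measurable_funD => //; exact: measurable_funM.
pose nu : {measure set (measurableTypeR R) -> \bar R} :=
   (@measure_function_pushforward__canonical__measure_function_Measure _ _ _ _ _
    mu _ mphi).
transitivity (\int[mscale (NngNum (normr_ge0 a)) nu]_t f t)%E.
  rewrite ge0_integral_mscale//=; congr (_ * _)%E.
  by rewrite ge0_integral_pushforward//= preimage_setT.
apply: eq_measure_integral => A mA _.
by rewrite [RHS](@lebesgue_affine_preimage a b).
Qed.

End lebesgue_affine.

Section leb_affine.
Context (R : realType).
Local Notation mu := (@lebesgue_measure R).

Lemma measurable_affine m n (A : 'M[R]_(m, n)) b :
  measurable_fun setT (fun x : 'rV[R]_m => x *m A + b).
Proof.
apply: measurable_fun_rv => j; under eq_fun do rewrite mxE.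
apply: measurable_funD => //; under eq_fun do rewrite mxE.
apply: measurable_sum => k; apply: measurable_funM => //.
exact: measurable_coor.
Qed.

(** The linear change of variables as a predicate on the matrix, so that it can be propagated
    through products. The translation [b] is part of it because the sections of a linear map are
    affine. *)
Definition leb_scales n (A : 'M[R]_n) :=
  forall (f : 'rV[R]_n -> \bar R) b, measurable_fun setT f ->
   (forall x, 0 <= f x)%E ->
  (`|\det A|%:E * \int[leb R n]_x f (x *m A + b)%R = \int[leb R n]_x f x)%E.

Lemma leb_scalesM n (A B : 'M[R]_n) :
  leb_scales A -> leb_scales B -> leb_scales (A *m B).
Proof.
move=> hA hB f b mf f0; rewrite det_mulmx normrM mulrC EFinM -muleA.
rewrite -(hB f b)//; congr (_ * _)%E.
rewrite -(hA (fun x => f (x *m B + b)) 0)//; last first.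
  exact: (measurableT_comp mf (measurable_affine _ _)).
by congr (_ * _)%E; apply: eq_integral => x _; rewrite addr0 mulmxA.
Qed.

Lemma measurable_rcons0_snd n (t : R) :
  measurable_fun setT (fun y : 'rV[R]_n => rcons0 (t, y)).
Proof.
apply: measurable_fun_rv => i; case: (unliftP ord0 i) => [j ->|->].
  under eq_fun do rewrite rcons0_S.
  exact: measurable_coor.
under eq_fun do rewrite rcons0_0 /=.
exact: measurable_cst.
Qed.

Lemma measurable_rcons0_fst n (y : 'rV[R]_n) :
  measurable_fun setT (fun t : R => rcons0 (t, y)).
Proof.
apply: measurable_fun_rv => i; case: (unliftP ord0 i) => [j ->|->].
  under eq_fun do rewrite rcons0_S /=.
  exact: measurable_cst.
under eq_fun do rewrite rcons0_0 /=.
by move=> _ Y mY; rewrite setTI.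
Qed.

Lemma rcons0D n (s t : R) (y z : 'rV[R]_n) :
  rcons0 (s, y) + rcons0 (t, z) = rcons0 (s + t, y + z).
Proof.
apply/rowP => i; rewrite mxE; case: (unliftP ord0 i) => [j ->|->].
  by rewrite !rcons0_S mxE.
by rewrite !rcons0_0.
Qed.

Lemma mul_rcons0_block n t (y : 'rV[R]_n) (a : R) v (c : 'cV[R]_n) (D : 'M[R]_n) :
  (rcons0 (t, y) : 'rV_(1 + n)) *m block_mx a%:M v c D =
  rcons0 (t * a + (y *m c) 0 0, t *: v + y *m D).
Proof.
rewrite /rcons0 mul_row_block/= mul_scalar_mx scale_scalar_mx mul_scalar_mx.
by rewrite raddfD/= -mx11_scalar.
Qed.

(** With the first coordinate [t] fixed, the map is [D] followed by a translation by [t *: v + w];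
    integrating over the other coordinates first leaves a one-dimensional affine substitution in
    [t]. *)
Lemma leb_scales_ublock n (a : R) (v : 'rV[R]_n) (D : 'M[R]_n) : a != 0 ->
  leb_scales D -> leb_scales (block_mx a%:M v 0 D : 'M[R]_(1 + n)).
Proof.
move=> a0 hD f b mf f0.
rewrite det_ublock det_scalar1 normrM EFinM.
have [c [w ->]] : exists c w, b = rcons0 (c, w).
  by exists (rsplit0 b).1, (rsplit0 b).2; rewrite -surjective_pairing rsplit0K.
rewrite lebS_integral//; last exact: (measurableT_comp mf (measurable_affine _ _)).
rewrite lebS_integral//.
have mG := measurable_lebS mf f0.
rewrite -(@integral_lebesgue_affine _ a c _ a0 mG)//; last first.
  by move=> t; exact: integral_ge0.
rewrite -muleA; congr (_ * _)%E.
rewrite -ge0_integralZl//=.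
- apply: eq_integral => t _.
  rewrite -[RHS](hD _ (t *: v + w) (measurableT_comp mf (measurable_rcons0_snd _))).
    congr (_ * _)%E; apply: eq_integral => y _; congr f.
    by rewrite mul_rcons0_block mulmx0 mxE addr0 rcons0D (mulrC t) (addrCA (y *m D)) !addrA.
  by move=> y; exact: f0.
- have mf' : measurable_fun setT (fun x : 'rV[R]_n.+1 =>
      f (x *m (block_mx a%:M v 0 D : 'M[R]_(1 + n)) + rcons0 (c, w))).
    exact: (measurableT_comp mf (measurable_affine _ _)).
  by apply: (measurable_lebS mf') => x; exact: f0.
- by move=> t _; exact: integral_ge0.
Qed.

Lemma leb_scales_1 n : leb_scales (1%:M : 'M[R]_n).
Proof.
elim: n => [|n IH]; last first.
  have -> : (1%:M : 'M[R]_n.+1) = (block_mx 1%:M 0 0 1%:M : 'M[R]_(1 + n)).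
    by rewrite [LHS](@scalar_mx_block _ 1 n).
  by apply: leb_scales_ublock => //; exact: oner_neq0.
move=> f b mf f0; rewrite det_mx00 normr1 mul1e !leb0_integral//; congr f.
by apply/rowP; case.
Qed.

(** Here the first coordinate is translated by an amount depending on the others, so it is the one
    integrated first. *)
Lemma leb_scales_lshear n (c : 'cV[R]_n) :
  leb_scales (block_mx 1%:M 0 c 1%:M : 'M[R]_(1 + n)).
Proof.
move=> f b mf f0.
rewrite det_lblock !det1 mulr1 normr1 mul1e.
have [d [w ->]] : exists d w, b = rcons0 (d, w).
  by exists (rsplit0 b).1, (rsplit0 b).2; rewrite -surjective_pairing rsplit0K.
rewrite lebS_integral'//; last exact: (measurableT_comp mf (measurable_affine _ _)).
pose g y := (\int[mu]_t f (rcons0 (t, y)))%E.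
have mg : measurable_fun setT g.
  apply: (@measurable_fun_fubini_tonelli_G _ _ _ _ _ mu (fun p => f (rcons0 p))) => //.
  exact: (measurableT_comp mf (@measurable_rcons0 R n)).
have g0 y : (0 <= g y)%E by exact: integral_ge0.
transitivity (\int[leb R n]_y g (y *m 1%:M + w)%R)%E; last first.
  transitivity (\int[leb R n]_y g y)%E; last exact/esym/lebS_integral'.
  have := leb_scales_1 w mg g0.
  by move: (leb R n) => m <-; rewrite det1 normr1 mul1e.
apply: eq_integral => y _; rewrite mulmx1.
have mfy := measurableT_comp mf (measurable_rcons0_fst (y + w)).
transitivity (\int[mu]_t f (rcons0 (1 * t + ((y *m c) 0 0 + d), y + w)%R))%E.
  apply: eq_integral => t _; congr f.
  by rewrite mul_rcons0_block scaler0 add0r mulmx1 rcons0D mulr1 mul1r addrA.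
have := @integral_lebesgue_affine _ 1 ((y *m c) 0 0 + d) _ (oner_neq0 _) mfy.
by rewrite normr1 mul1e; apply => t; exact: f0.
Qed.

(** Gaussian elimination: a matrix with nonzero corner is a shear times a block triangular matrix,
    whose lower block is the Schur complement and falls under the induction hypothesis. *)
Lemma leb_scales_unit n (A : 'M[R]_n) : A \in unitmx -> leb_scales A.
Proof.
elim: n A => [A _|n IH A uA].
  by rewrite (flatmx0 A) -(flatmx0 1%:M); exact: leb_scales_1.
have key (B : 'M[R]_(1 + n)) : B \in unitmx -> B ord0 ord0 != 0 -> leb_scales B.
  move=> uB; set a := B ord0 ord0 => a0.
  pose v := ursubmx B; pose c := dlsubmx B; pose D := drsubmx B.
  have BE : B = block_mx a%:M v c D.
    rewrite -[LHS]submxK; congr block_mx.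
    rewrite [LHS]mx11_scalar; congr (_%:M); rewrite !mxE /a.
    by congr (B _ _); exact/val_inj.
  have BE' : B = block_mx 1%:M 0 (a^-1 *: c) 1%:M *m
                 block_mx a%:M v 0 (D - a^-1 *: c *m v).
    rewrite BE mulmx_block !mul1mx !mul0mx !addr0.
    by rewrite mul_mx_scalar scalerA divff// scale1r addrC subrK.
  rewrite BE'; apply: leb_scalesM; first exact: leb_scales_lshear.
  apply: leb_scales_ublock => //; apply: IH.
  move: uB; rewrite BE' unitmx_mul => /andP[_].
  by rewrite !unitmxE det_ublock det_scalar1 unitrM => /andP[].
have [A0|] := eqVneq (A ord0 ord0) 0; last exact: key.
have [i Ai0] : exists i, A (lift ord0 i) ord0 != 0.
  apply/existsP; apply: contraTT uA; rewrite negb_exists => /forallP Ai0.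
  rewrite unitmxE (expand_det_col _ ord0) big1 ?unitr0// => i _.
  case: (unliftP ord0 i) => [j ->|->]; last by rewrite A0 mul0r.
  by have := Ai0 j; rewrite negbK => /eqP ->; rewrite mul0r.
(* Multiplying by [U 1] on the left adds to the first row a row whose leading entry is nonzero;
   [U (-1)] undoes this. *)
pose U (e : R) : 'M[R]_(1 + n) := block_mx 1%:M (e *: delta_mx ord0 i) 0 1%:M.
have UU e : leb_scales (U e) by apply: leb_scales_ublock; [exact: oner_neq0|exact: leb_scales_1].
have uU e : U e \in unitmx by rewrite unitmxE det_ublock !det1 mulr1 unitr1.
have UVE : U (-1) *m U 1 = 1%:M.
  rewrite mulmx_block !mul1mx !mulmx0 !mul0mx !addr0 mulmx1 add0r.
  by rewrite scaleN1r scale1r subrr -scalar_mx_block.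
have -> : A = U (-1) *m (U 1 *m A) by rewrite mulmxA UVE mul1mx.
apply: leb_scalesM; first exact: UU.
apply: key; first by rewrite unitmx_mul uU.
rewrite mxE big_ord_recl A0 mulr0 add0r (bigD1 i)//= big1 ?addr0.
  suff -> : U 1 ord0 (lift ord0 i) = 1 by rewrite mul1r.
  rewrite /U (_ : lift ord0 i = rshift 1 i); last exact/val_inj.
  rewrite (_ : ord0 = lshift n (ord0 : 'I_1)); last exact/val_inj.
  by rewrite block_mxEur !mxE !eqxx mul1r.
move=> j ji; suff -> : U 1 ord0 (lift ord0 j) = 0 by rewrite mul0r.
rewrite /U (_ : lift ord0 j = rshift 1 j); last exact/val_inj.
rewrite (_ : ord0 = lshift n (ord0 : 'I_1)); last exact/val_inj.
by rewrite block_mxEur !mxE (negbTE ji) andbF mulr0.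
Qed.

Lemma leb_preimage_affine n (A : 'M[R]_n) b (S : set 'rV[R]_n) :
  A \in unitmx -> measurable S ->
  (`|\det A|%:E * leb R n ((fun x => (x *m A + b)%R) @^-1` S) = leb R n S)%E.
Proof.
move=> uA mS; rewrite -[in RHS](setIT S) -integral_indic//.
have mI : measurable_fun setT (EFin \o (\1_S : 'rV[R]_n -> R)).
  by apply/measurable_EFinP; exact: measurable_indic.
rewrite -[RHS](leb_scales_unit uA b mI)//; last by move=> x; rewrite lee_fin.
rewrite -[X in leb R n X]setIT -integral_indic//.
by rewrite -[X in measurable X]setTI; exact: measurable_affine.
Qed.

End leb_affine.

(** * Subdivision of cubes and transport *)

Section rv_norm.
Context (R : realType).

Lemma rv_norm_coor n (x : 'rV[R]_n) i : `|x ord0 i| <= `|x|.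
Proof.
rewrite [leRHS]/Num.Def.normr /= mx_normrE; apply/bigmax_geP; right => /=.
by exists (ord0, i).
Qed.

Lemma rv_norm_le n (x : 'rV[R]_n) e : 0 <= e ->
  (forall i, `|x ord0 i| <= e) -> `|x| <= e.
Proof.
move=> e0 xe; rewrite [leLHS]/Num.Def.normr /= mx_normrE; apply/bigmax_leP; split=> //.
by move=> [i j] _ /=; rewrite (ord1 i).
Qed.

Lemma measurable_half_cube n (a : 'rV[R]_n) l :
  measurable [set y : 'rV[R]_n | forall i, a ord0 i <= y ord0 i < a ord0 i + l].
Proof.
rewrite (_ : mkset _ = \bigcap_(i in [set: 'I_n])
    ((fun y : 'rV[R]_n => y ord0 i) @^-1` `[a ord0 i, a ord0 i + l[%classic)); last first.
  apply/seteqP; split => y /= ya i; last by have := ya i I; rewrite /= in_itv.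
  by move=> _; rewrite /= in_itv/=.
apply: fin_bigcap_measurable => // i _.
by rewrite -[X in measurable X]setTI; exact: measurable_coor.
Qed.

End rv_norm.

(** Half-open, so that the $2^n$ halves of a cube partition it. *)
Definition half_cube (R : realType) n (a : 'rV[R]_n) (l : R) : set 'rV[R]_n :=
  [set y | forall i, a ord0 i <= y ord0 i < a ord0 i + l].

Section cubes.
Context (R : realType).

Lemma leb_half_cube n (a : 'rV[R]_n) l : 0 <= l ->
  leb R n (half_cube a l) = (l ^+ n)%:E.
Proof.
move=> l0; elim: n a => [|n IH] a.
  by rewrite /= diracE mem_set// => -[].
rewrite lebSE exprS.
pose a' := (rsplit0 a).2.
pose I : set (measurableTypeR R) := `[a ord0 ord0, a ord0 ord0 + l[%classic.
have mI : measurable I by exact: measurable_itv.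
transitivity (\int[lebesgue_measure]_t ((l ^+ n)%:E * (\1_I t)%:E))%E; last first.
  rewrite ge0_integralZl//; first last.
    by rewrite lee_fin exprn_ge0.
    by apply/measurable_EFinP; exact: measurable_indic.
  rewrite integral_indic//= setIT /I lebesgue_measure_itv/= lte_fin.
  rewrite -EFinB (addrC (a ord0 ord0)) addrK ltrDr.
  have [l1|l1] := ltP 0 l; first by rewrite -EFinM mulrC.
  by rewrite mule0; have -> : l = 0; [apply/eqP; rewrite eq_le l1|rewrite mul0r].
apply: eq_integral => t _; rewrite indicE; have [tI|tI] := boolP (t \in _).
  rewrite mule1 -(IH a'); congr (leb R n _).
  move: tI; rewrite inE /I/= in_itv/= => tI.
  apply/seteqP; split => y /= yA i.
    by have := yA (lift ord0 i); rewrite rcons0_S/= mxE.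
  case: (unliftP ord0 i) => [j ->|->]; last by rewrite rcons0_0.
  by rewrite rcons0_S; have := yA j; rewrite mxE.
rewrite mule0 -[RHS](measure0 (leb R n)); congr (leb R n _).
rewrite -subset0 => y /(_ ord0); rewrite rcons0_0 /= => tA.
by move/negP: tI; apply; rewrite inE /I/= in_itv.
Qed.

(** If [P] fails on a cube, it fails on one of its halves; the nested failing cubes shrink to a
    point [y], where the local hypothesis is contradicted. That hypothesis speaks of closed cubes
    because [y] may lie on the boundary of the half-open ones. *)
Lemma cousin n (P : 'rV[R]_n -> R -> Prop) :
  (forall (a : 'rV[R]_n) l, 0 < l -> (forall s : {ffun 'I_n -> bool},
     P (\row_i (a ord0 i + (s i)%:R * (l / 2))) (l / 2)) -> P a l) ->
  (forall y : 'rV[R]_n, exists2 d, 0 < d & forall (a : 'rV[R]_n) l, 0 < l <= d ->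
     (forall i, a ord0 i <= y ord0 i <= a ord0 i + l) -> P a l) ->
  forall a l, 0 < l -> P a l.
Proof.
move=> Psub Ploc a l l0; apply: contrapT => nP.
pose child (p : 'rV[R]_n * R) (s : {ffun 'I_n -> bool}) : 'rV[R]_n :=
  \row_i (p.1 ord0 i + (s i)%:R * (p.2 / 2)).
pose sel p := xget [ffun=> false] [set s | ~ P (child p s) (p.2 / 2)].
pose next p := (child p (sel p), p.2 / 2).
pose c k := iter k next (a, l).
have c2 k : (c k).2 = l / 2 ^+ k.
  elim: k => [|k IH]; first by rewrite /= expr0 divr1.
  by rewrite /= -/(c k) IH exprS invfM mulrA mulrAC.
have c2_gt0 k : 0 < (c k).2 by rewrite c2 divr_gt0// exprn_gt0.
have nPc k : ~ P (c k).1 (c k).2.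
  elim: k => // k IH; rewrite /= -/(c k) /next /=.
  rewrite /sel; case: xgetP => // noS.
  exfalso; apply: IH; apply: Psub => // s.
  by apply: contrapT => nPs; exact: (noS s).
have c1 k i : (c k).1 ord0 i <= (c k.+1).1 ord0 i <= (c k).1 ord0 i + (c k.+1).2.
  rewrite /= -/(c k) mxE lerDl; have := c2_gt0 k; case: (sel _ i) => /= ck.
    by rewrite mul1r lexx andbT divr_ge0 ?ltW.
  by rewrite mul0r lexx/= addr0 lerDl divr_ge0 ?ltW.
have c1S k i : (c k.+1).1 ord0 i + (c k.+1).2 <= (c k).1 ord0 i + (c k).2.
  have /andP[_ h] := c1 k i; rewrite (le_trans (lerD h (lexx _)))//.
  by rewrite -addrA lerD2l /= -splitr.
have inc k j i : (c k).1 ord0 i <= (c (k + j)%N).1 ord0 i.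
  elim: j => [|j IH]; first by rewrite addn0.
  by rewrite addnS (le_trans IH)//; case/andP: (c1 (k + j)%N i).
have dec k j i : (c (k + j)%N).1 ord0 i + (c (k + j)%N).2 <= (c k).1 ord0 i + (c k).2.
  elim: j => [|j IH]; first by rewrite addn0.
  by rewrite addnS (le_trans _ IH)//; exact: c1S.
have cross j k i : (c j).1 ord0 i <= (c k).1 ord0 i + (c k).2.
  have := inc j (k - j)%N i; have := dec k (j - k)%N i.
  have := c2_gt0 j; have := c2_gt0 k.
  have [jk|/ltnW kj] := leqP j k.
    by rewrite (subnKC jk); move: jk; rewrite -subn_eq0 => /eqP ->; rewrite addn0; lra.
  by rewrite (subnKC kj); move: kj; rewrite -subn_eq0 => /eqP ->; rewrite addn0; lra.
pose y : 'rV[R]_n := \row_i sup (range (fun k => (c k).1 ord0 i)).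
have yc k i : (c k).1 ord0 i <= y ord0 i <= (c k).1 ord0 i + (c k).2.
  rewrite mxE; apply/andP; split.
    apply: ub_le_sup; last by exists k.
    by exists ((c 0%N).1 ord0 i + (c 0%N).2) => _ [j _ <-]; exact: cross.
  apply: ge_sup; first by exists ((c 0%N).1 ord0 i); exists 0%N.
  by move=> _ [j _ <-]; exact: cross.
have [d d0 Pd] := Ploc y.
have [k kd] : exists k, (c k).2 <= d.
  exists (Num.truncn (l / d)).+1; rewrite c2 ler_pdivrMr ?exprn_gt0// mulrC -ler_pdivrMr//.
  apply: (le_trans (ltW (truncnS_gt _))).
  by rewrite -natrX ler_nat ltnW// ltn_expl.
by apply: (nPc k); apply: Pd; [rewrite c2_gt0|exact: yc].
Qed.

Lemma half_cube_split n (a : 'rV[R]_n) l : 0 < l ->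
  half_cube a l = \big[setU/set0]_(s <- index_enum {ffun 'I_n -> bool})
    half_cube (\row_i (a ord0 i + (s i)%:R * (l / 2))) (l / 2).
Proof.
move=> l0; rewrite -bigcup_seq; apply/seteqP; split => y.
  move=> ya.
  exists [ffun i => a ord0 i + l / 2 <= y ord0 i] => /=; first exact: mem_index_enum.
  move=> i; rewrite mxE ffunE; have /andP[y1 y2] := ya i.
  case: (leP (a ord0 i + l / 2) (y ord0 i)) => h /=; first by rewrite mul1r -addrA -splitr h y2.
  by rewrite mul0r addr0 y1 h.
move=> [s _] ys i; have := ys i; rewrite mxE.
case: (s i) => /=; rewrite ?mul1r ?mul0r ?addr0 => /andP[h1 h2]; apply/andP; split; lra.
Qed.

Lemma half_cube_triv n (a : 'rV[R]_n) l : 0 < l ->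
  trivIset setT (fun s : {ffun 'I_n -> bool} =>
    half_cube (\row_i (a ord0 i + (s i)%:R * (l / 2))) (l / 2)).
Proof.
move=> l0; apply/trivIsetP => s t _ _ st; rewrite -subset0 => y [ys yt].
apply/negP: st; apply/negPn/eqP/ffunP => i.
have := ys i; have := yt i; rewrite !mxE.
by case: (s i); case: (t i) => //=; rewrite ?mul1r ?mul0r ?addr0 => /andP[h1 h2] /andP[h3 h4]; exfalso; lra.
Qed.

Lemma expr_1D_le (m : nat) (e : R) : 0 < e -> exists2 r, 0 < r & (1 + r) ^+ m <= 1 + e.
Proof.
elim: m e => [|m IH] e e0; first by exists 1 => //; rewrite expr0; lra.
have [r r0 hr] := IH (e / 2) (divr_gt0 e0 (ltr0Sn _ _)).
have e2 : 0 < 2 + e by lra.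
(* The bound [e / (2 + e)] is the solution of $(1+e/2)(1+s)=1+e$. *)
exists (Num.min r (e / (2 + e))); first by rewrite lt_min r0 divr_gt0.
set s := Num.min _ _.
have s0 : 0 < s by rewrite /s lt_min r0 divr_gt0.
have sr : s <= r by rewrite /s ge_min lexx.
have se : s <= e / (2 + e) by rewrite /s ge_min lexx orbT.
rewrite exprSr; apply: (@le_trans _ _ ((1 + e / 2) * (1 + e / (2 + e)))).
  apply: ler_pM; [by apply: exprn_ge0; lra|by lra| |by lra].
  by apply: le_trans hr; apply: lerXn2r; rewrite ?nnegrE; lra.
rewrite le_eqVlt; apply/orP; left; apply/eqP; field.
by rewrite gt_eqF.
Qed.

End cubes.

Lemma nbhs_rvP (R : realType) n (x : 'rV[R]_n) (P : set 'rV[R]_n) : (\forall y \near x, P y) ->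
  exists2 d, 0 < d & forall y, `|y - x| <= d -> P y.
Proof.
move=> /nbhs_ballP[e /= e0 h]; exists (e / 2); first by rewrite divr_gt0.
move=> y yx; apply: h; rewrite -ball_normE /= distrC (le_lt_trans yx)//.
by rewrite gtr_pMr// invf_lt1 ?ltr1n.
Qed.

Lemma le_mul1De (R : realType) (x y : \bar R) : (0 <= y)%E ->
  (forall e : R, 0 < e -> (x <= (1 + e)%:E * y)%E) -> (x <= y)%E.
Proof.
case: y => [y| |] // y0 xy; last by rewrite leey.
apply/lee_addgt0Pr => e e0; have y1 : 0 < y + 1 by rewrite ltr_wpDl.
apply: (le_trans (xy (e / (y + 1)) (divr_gt0 e0 y1))).
rewrite -EFinM -EFinD lee_fin mulrDl mul1r lerD2l mulrAC ler_pdivrMr// ler_wpM2l ?ltW//.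
by rewrite ltrDl.
Qed.

Section transport.
Context (R : realType) (n : nat).
Variables (Theta : 'rV[R]_n -> 'rV[R]_n) (D : 'rV[R]_n -> 'M[R]_n) (L : R).
Variables (h g : 'rV[R]_n -> R).
Hypothesis L0 : 0 < L.
Hypothesis expand : forall x y, `|x - y| <= L * `|Theta x - Theta y|.
Hypothesis diff : forall x e, 0 < e -> exists2 d, 0 < d &
  forall y, `|y - x| <= d ->
    `|Theta y - Theta x - (y - x) *m D x| <= e * `|y - x|.
Hypothesis unitD : forall x, D x \in unitmx.
Hypothesis ctheta : continuous Theta.
Hypothesis mtheta : measurable_fun setT Theta.
Hypothesis ch : continuous h.
Hypothesis cg : continuous g.
Hypothesis mh : measurable_fun setT h.
Hypothesis mg : measurable_fun setT g.
Hypothesis h0 : forall x, 0 <= h x.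
Hypothesis g0 : forall x, 0 < g x.
Hypothesis hg : forall x, h x <= `|\det (D x)| * g (Theta x).

(** Both integrals are localised over sets [A] of the target space, where the bisection takes place;
    injectivity of [Theta] follows from [expand]. *)
Let nu A := (\int[leb R n]_(x in Theta @^-1` A) (h x)%:E)%E.
Let gam A := (\int[leb R n]_(x in A) (g x)%:E)%E.

Let mpre A : measurable A -> measurable (Theta @^-1` A).
Proof. by move=> mA; rewrite -[X in measurable X]setTI; exact: mtheta. Qed.

(** By [expand], points mapped into a cube of side [l] around [Theta x0] are within [L * l] of [x0].
    There [Theta] is affine up to an error [r * l / 2], so the preimage of the cube lies in the
    affine preimage of a cube of side [l * (1 + r)]. *)
Let local_image e : 0 < e -> forall x0, exists2 d, 0 < d &
  forall (a : 'rV[R]_n) l, 0 < l <= d ->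
  (forall i, a ord0 i <= Theta x0 ord0 i <= a ord0 i + l) ->
  (nu (half_cube a l) <= (1 + e)%:E * gam (half_cube a l))%E.
Proof.
move=> e0 x0; set y := Theta x0; set A := D x0.
(* Of the [n.+2] factors [1 + r], [n] pay for the enlarged cube, one for the variation of [h] and
   one for that of [g]. *)
have [r r0 hr] := expr_1D_le n.+2 e0.
have r1 : 0 < 1 + r by lra.
have dA : 0 < `|\det A| by rewrite normr_gt0 -unitfE -unitmxE; exact: unitD.
have gy := g0 y.
have /nbhs_rvP[d1 d1_gt0 hd1] : \forall x \near x0, h x <= (1 + r) * (`|\det A| * g y).
  apply: (cvgr_le _ (@ch x0)); apply: (le_lt_trans (hg x0)).
  by rewrite ltr_pMl ?mulr_gt0//; lra.
have /nbhs_rvP[d2 d2_gt0 hd2] : \forall z \near y, g y / (1 + r) <= g z.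
  apply: (cvgr_ge _ (@cg y)); rewrite ltr_pdivrMr// ltr_pMr//; lra.
have [d3 d3_gt0 hd3] := @diff x0 (r / (2 * L)) (divr_gt0 r0 (mulr_gt0 (ltr0Sn _ _) L0)).
exists (Num.min d2 (Num.min (d1 / L) (d3 / L))).
  by rewrite !lt_min d2_gt0 !divr_gt0.
move=> a l /andP[l0]; rewrite !le_min => /and3P[ld2 ld1 ld3] ay.
have near_y z : half_cube a l z -> `|z - y| <= l.
  move=> za; apply: rv_norm_le; first exact: ltW.
  move=> i; rewrite !mxE ler_norml; have /andP[? ?] := za i; have /andP[? ?] := ay i.
  by apply/andP; split; lra.
have near_x x : half_cube a l (Theta x) -> `|x - x0| <= L * l.
  by move=> /near_y ?; rewrite (le_trans (expand _ _))// ler_wpM2l// ltW.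
pose a' : 'rV[R]_n := \row_i (a ord0 i - r * l / 2).
pose l' := l * (1 + r).
have l'0 : 0 < l' by rewrite mulr_gt0.
have sub : Theta @^-1` half_cube a l `<=`
    (fun x => x *m A + (y - x0 *m A)) @^-1` half_cube a' l'.
  move=> x; rewrite [X in X -> _]/preimage /= => xa; have xx0 := near_x _ xa.
  have : `|Theta x - y - (x - x0) *m A| <= r * l / 2.
    apply: (le_trans (hd3 x _)); first by rewrite (le_trans xx0)// mulrC -ler_pdivlMr.
    apply: (le_trans (ler_wpM2l _ xx0)).
      by rewrite divr_ge0 ?ltW// mulr_gt0.
    rewrite le_eqVlt; apply/orP; left; apply/eqP; field.
    by rewrite gt_eqF.
  rewrite /preimage /half_cube /= mulmxBl.
  move: (Theta x) xa (x *m A) (x0 *m A) => z za u v err i.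
  have := le_trans (rv_norm_coor _ i) err.
  rewrite /l' /a' !mxE ler_norml => /andP[e1 e2].
  have /andP[z1 z2] := za i.
  by apply/andP; split; lra.
have mC : measurable (half_cube a l) by exact: measurable_half_cube.
have mC' : measurable (half_cube a' l') by exact: measurable_half_cube.
have mpreC' : measurable ((fun x => x *m A + (y - x0 *m A)) @^-1` half_cube a' l').
  by rewrite -[X in measurable X]setTI; exact: measurable_affine.
have volC : (leb R n (Theta @^-1` half_cube a l) <= (l' ^+ n / `|\det A|)%:E)%E.
  apply: (@le_trans _ _ (leb R n ((fun x => x *m A + (y - x0 *m A)) @^-1` half_cube a' l'))).
    by apply: le_measure => //; rewrite inE//; exact: mpre.
  rewrite -(@lee_pmul2l _ `|\det A|%:E)//=.
  rewrite leb_preimage_affine//; last exact: unitD.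
  rewrite leb_half_cube; last exact: ltW.
  by rewrite -EFinM mulrCA divff ?mulr1// gt_eqF.
apply: (@le_trans _ _ (((1 + r) * (`|\det A| * g y))%:E * (l' ^+ n / `|\det A|)%:E)%E).
  apply: (@le_trans _ _ (\int[leb R n]_(x in Theta @^-1` half_cube a l) (cst ((1 + r) * (`|\det A| * g y))%:E x))%E).
    apply: ge0_le_integral => //.
    - exact: mpre.
    - by move=> x _; rewrite lee_fin.
    - by apply/measurable_EFinP; exact: measurable_funTS.
    - move=> x xa; rewrite lee_fin; apply: hd1.
      by rewrite (le_trans (near_x _ xa))// mulrC -ler_pdivlMr.
  rewrite integral_cst; last exact: mpre.
  by apply: lee_wpmul2l => //; rewrite lee_fin !mulr_ge0// ltW.
apply: (@le_trans _ _ ((1 + e)%:E * ((g y / (1 + r))%:E * (l ^+ n)%:E))%E).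
  rewrite -!EFinM lee_fin /l' exprMn.
  have -> : (1 + r) * (`|\det A| * g y) * (l ^+ n * (1 + r) ^+ n / `|\det A|) =
      (1 + r) ^+ n.+2 * (g y / (1 + r) * l ^+ n).
    rewrite !exprS; field.
    by rewrite !gt_eqF.
  apply: ler_wpM2r => //; rewrite mulr_ge0 ?divr_ge0 ?exprn_ge0//; exact: ltW.
apply: lee_wpmul2l; first by rewrite lee_fin; lra.
rewrite -(@leb_half_cube _ _ a); last exact: ltW.
rewrite -integral_cst//.
apply: ge0_le_integral => //.
- by move=> z _; rewrite lee_fin divr_ge0// ltW.
- by apply/measurable_EFinP; exact: measurable_funTS.
- by move=> z za; rewrite lee_fin; apply: hd2; rewrite (le_trans (near_y _ za)).
Qed.

(* On a small cube around [Theta x0] the inequality holds up to a factor [1 + e],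
   because [Theta] is nearly affine near [x0]; the points outside the range of
   [Theta] have a neighbourhood with empty preimage.  [cousin] reduces every cube
   to small ones. *)
Lemma transport_le :
  (\int[leb R n]_x (h x)%:E <= \int[leb R n]_x (g x)%:E)%E.
Proof.
suff cubes a l : 0 < l -> (nu (half_cube a l) <= gam (half_cube a l))%E.
  pose C (k : nat) : set 'rV[R]_n := half_cube (const_mx (- k%:R)) (2 * k%:R).
  have mC k : measurable (C k) by exact: measurable_half_cube.
  have ndC : nondecreasing_seq C.
    move=> k j kj; apply/subsetPset => y yk i; have := yk i; rewrite !mxE.
    have : k%:R <= j%:R :> R by rewrite ler_nat.
    by move=> ? /andP[? ?]; apply/andP; split; lra.
  have CT : \bigcup_k C k = setT.
    apply/seteqP; split => // y _; exists (Num.truncn `|y|).+1 => // i.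
    have := le_lt_trans (rv_norm_coor y i) (truncnS_gt _).
    by rewrite !mxE ltr_norml => /andP[? ?]; apply/andP; split; lra.
  have nd' : nondecreasing_seq (fun k => Theta @^-1` C k).
    by move=> k j /ndC/subsetPset kj; apply/subsetPset => x; exact: kj.
  have cvn : (nu (C k) @[k --> \oo] --> \int[leb R n]_x (h x)%:E)%E.
    have := @ge0_nondecreasing_set_cvg_integral _ _ R (fun k => Theta @^-1` C k)
       (EFin \o h) (leb R n) nd' (fun k => mpre (mC k)).
    rewrite -preimage_bigcup CT preimage_setT; apply => //.
    + by move=> k; apply/measurable_EFinP; exact: measurable_funTS.
    + by move=> k x _; rewrite lee_fin.
  have cvg : (gam (C k) @[k --> \oo] --> \int[leb R n]_x (g x)%:E)%E.
    have := @ge0_nondecreasing_set_cvg_integral _ _ R C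
       (EFin \o g) (leb R n) ndC mC.
    rewrite CT; apply => //.
    + by move=> k; apply/measurable_EFinP; exact: measurable_funTS.
    + by move=> k x _; rewrite lee_fin ltW.
  apply: (lee_cvg_to cvn cvg) => //.
  near=> k; apply: cubes; rewrite mulr_gt0// ltr0n.
  by near: k; exists 1%N.
move=> l0; apply: le_mul1De.
  by apply: integral_ge0 => x _; rewrite lee_fin ltW.
move=> e e0.
pose P (a : 'rV[R]_n) l := (nu (half_cube a l) <= (1 + e)%:E * gam (half_cube a l))%E.
move: a l l0; apply: (@cousin _ _ P) => [a l l0 Ps|y].
  rewrite /P.
  pose F (s : {ffun 'I_n -> bool}) :=
    half_cube (\row_i (a ord0 i + (s i)%:R * (l / 2))) (l / 2).
  have mF s : measurable (F s) by exact: measurable_half_cube.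
  have tF : trivIset [set` index_enum {ffun 'I_n -> bool}] F.
    by move=> s t _ _ st; apply: (half_cube_triv l0 I I st).
  have tF' : trivIset [set` index_enum {ffun 'I_n -> bool}] (fun s => Theta @^-1` F s).
    move=> s t ? ? [x [xs xt]]; apply: tF => //; by exists (Theta x).
  rewrite half_cube_split// /nu /gam.
  have -> : Theta @^-1` (\big[setU/set0]_(s <- index_enum {ffun 'I_n -> bool}) F s) =
      \big[setU/set0]_(s <- index_enum {ffun 'I_n -> bool}) (Theta @^-1` F s).
    by rewrite -!bigcup_seq preimage_bigcup.
  rewrite ge0_integral_bigsetU//; last 4 first.
  - by move=> s; exact: mpre.
  - exact: index_enum_uniq.
  - by apply/measurable_EFinP; exact: measurable_funTS.
  - by move=> x _; rewrite lee_fin.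
  rewrite [in leRHS]ge0_integral_bigsetU//; last 3 first.
  - exact: index_enum_uniq.
  - by apply/measurable_EFinP; exact: measurable_funTS.
  - by move=> x _; rewrite lee_fin ltW.
  rewrite ge0_sume_distrr; last first.
    by move=> s _; apply: integral_ge0 => x _; rewrite lee_fin ltW.
  by apply: lee_sum => s _; exact: Ps.
have [[x0 <-]|noy] := pselect (exists x, Theta x = y); first exact: local_image.
suff [d d0 dy] : exists2 d, 0 < d & forall x, d < `|Theta x - y|.
  exists d => // a l /andP[l0 ld] ay; rewrite /P /nu.
  rewrite (_ : _ @^-1` _ = set0).
    rewrite integral_set0 mule_ge0//; first by rewrite lee_fin; lra.
    by apply: integral_ge0 => x _; rewrite lee_fin ltW.
  rewrite -subset0 => x xa; have := dy x; rewrite ltNge => /negP; apply.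
  apply: rv_norm_le; first exact: ltW.
  move=> i; rewrite !mxE ler_norml; have /andP[? ?] := xa i; have /andP[? ?] := ay i.
  by apply/andP; split; lra.
(* Outside the ball [B], [expand] gives [|Theta x - Theta 0| > 2 * rho], so [Theta x] is farther
   from [y] than [Theta 0] is. The minimum over the compact [B] is therefore a global one, and
   positive since [y] is not attained. *)
pose rho := `|Theta 0 - y|.
pose B : set 'rV[R]_n := [set x | `|x| <= 2 * L * rho].
have rho0 : 0 <= rho by exact: normr_ge0.
have B0 : B 0 by rewrite /B/= normr0; apply: mulr_ge0 => //; rewrite mulr_ge0// ltW.
have cB : compact B.
  apply: bounded_closed_compact.
    by exists (2 * L * rho); split => [|M MM x /le_trans]; [exact: num_real|apply; exact: ltW].
  apply: (@closed_comp _ _ (fun x : 'rV[R]_n => `|x|) [set z | z <= 2 * L * rho]).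
    by move=> x _; exact: norm_continuous.
  exact: closed_le.
have cf : {within B, continuous (fun x => `|Theta x - y|)}.
  apply: continuous_subspaceT => x.
  apply: (@continuous_comp _ _ _ (fun x => Theta x - y) (fun z => `|z|)).
    by apply: (cvgB (@ctheta x)); exact: cvg_cst.
  exact: norm_continuous.
have [xm _ xmin] := EVT_min_rV (ex_intro _ 0 B0) cB cf.
have m0 : 0 < `|Theta xm - y|.
  by rewrite normr_gt0 subr_eq0; apply/eqP => e1; apply: noy; exists xm.
exists (`|Theta xm - y| / 2); first by rewrite divr_gt0.
move=> x; apply: (@lt_le_trans _ _ `|Theta xm - y|).
  by rewrite ltr_pdivrMr// ltr_pMr// ltr1n.
have [xB|xB] := leP `|x| (2 * L * rho); first by apply: xmin; rewrite inE.
apply: (@le_trans _ _ rho); first by apply: xmin; rewrite inE.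
have : 2 * L * rho < L * `|Theta x - Theta 0|.
  by rewrite (lt_le_trans xB)//; have := expand x 0; rewrite subr0.
rewrite mulrAC mulrC ltr_pM2l// => h1.
have : `|Theta x - Theta 0| <= `|Theta x - y| + rho.
  by rewrite /rho (distrC (Theta 0) y) ler_distD.
by move=> h2; lra.
Unshelve. all: by end_near. Qed.

End transport.

(** * Determinants *)

Section real_spectral.
Import complex spectral.
Context (R : realType) (n : nat).

(* [q k N] is the diagonal entry of [N] in the [k]-th vector of a unitary
   (possibly complex) eigenbasis of [M]. *)
Lemma real_spectral (M : 'M[R]_n) : M^T = M ->
  exists q : 'I_n -> {scalar 'M[R]_n},
   [/\ forall k (u : 'rV[R]_n), 0 <= q k (u^T *m u),
       forall k, q k 1%:M = 1,
       forall N, \sum_k q k N = \tr N &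
       forall a b, \det (a%:M + b *: M) = \prod_k (a + b * q k M)].
Proof.
move=> Msym.
pose MC := map_mx (real_complex R) M.
have MCh : MC \is hermsymmx.
  apply: realsym_hermsym; first by apply/is_hermitianmxP; rewrite expr0 scale1r map_mx_id// /MC map_trmx Msym.
  by apply/mxOverP => i j; rewrite mxE; apply/complex_realP; eexists.
have MCn : MC \is normalmx by exact: hermitian_normalmx.
have PU := spectral_unitarymx MC.
have MCE := orthomx_spectralP MCn.
have Dreal := hermitian_spectral_diag_real MCh.
move: (spectralmx MC) (spectral_diag MC) PU MCE Dreal => P D PU MCE Dreal.
pose Ps := map_mx Num.conj P^T.
have PPs : P *m Ps = 1%:M by apply/unitarymxP.
have PsP : Ps *m P = 1%:M by exact: mulmx1C.
have DE : P *m MC *m Ps = diag_mx D.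
  by rewrite MCE invmx_unitary// -/Ps !mulmxA PPs mul1mx -mulmxA PPs mulmx1.
(* The real part makes [q k] a linear form over the reals; on [M] it loses nothing, since the
   eigenvalues of a hermitian matrix are real. *)
pose q k (N : 'M[R]_n) : R := Re ((P *m map_mx (real_complex R) N *m Ps) k k).
have q_lin k : linear_for *%R (q k).
  move=> a A B; rewrite /q map_mxD map_mxZ mulmxDr mulmxDl -scalemxAr -scalemxAl.
  rewrite mxE [X in Re (X + _)]mxE /=.
  by move: (_ k k) (_ k k) => [x y] [x' y'] /=; rewrite mul0r subr0.
pose Q k : {scalar 'M[R]_n} := HB.pack (q k) (GRing.isLinear.Build _ _ _ _ (q k) (q_lin k)).
exists Q; split.
- move=> k u; rewrite /Q/= /q map_mxM.
  set v := map_mx _ u^T.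
  have -> : map_mx (real_complex R) u = map_mx Num.conj v^T.
    by apply/matrixP => i j; rewrite !mxE conj_Creal//; apply/complex_realP; eexists.
  rewrite mulmxA -mulmxA -map_mxM -trmx_mul !mxE big_ord1 !mxE.
  have := mul_conjC_ge0 ((P *m v) k 0); rewrite mxE lecE => /andP[_].
  by [].
- by move=> k; rewrite /Q/= /q map_scalar_mx mulmx1 PPs mxE eqxx.
- move=> N; rewrite /Q/= /q.
  have -> : \sum_k Re ((P *m map_mx (real_complex R) N *m Ps) k k) =
     Re (\tr (P *m map_mx (real_complex R) N *m Ps)).
    rewrite /mxtrace; elim/big_rec2: _ => // k x y _ ->.
    by move: (P *m _ *m Ps) => A; case: (A k k) => ? ?; case: x.
  rewrite mxtrace_mulC mulmxA PsP mul1mx /mxtrace.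
  elim/big_rec2: _ => // k x y _ <-; rewrite !mxE.
  by case: y.
- move=> a b; apply: (@complexI R); rewrite rmorph_prod -det_map_mx/=.
  have qD k : (q k M)%:C%C = D 0 k.
    have <- : (P *m MC *m Ps) k k = D 0 k by rewrite DE mxE eqxx mulr1n.
    rewrite /q RRe_real//; have -> : (P *m MC *m Ps) k k = D 0 k.
      by rewrite DE mxE eqxx mulr1n.
    exact: (mxOverP Dreal).
  rewrite map_mxD map_mxZ map_scalar_mx -/MC /=.
  transitivity (\det (P *m (a%:C%C%:M + b%:C%C *: MC) *m Ps)).
    by rewrite !det_mulmx mulrAC -det_mulmx PPs det1 mul1r.
  rewrite mulmxDr mulmxDl -scalemxAr -scalemxAl DE scalar_mxC -mulmxA PPs mulmx1.
  have -> : a%:C%C%:M + b%:C%C *: diag_mx D = diag_mx (\row_k (a%:C%C + b%:C%C * D 0 k)).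
    apply/matrixP => i j; rewrite !mxE.
    by have [->|_] := eqVneq i j; rewrite ?mulr1n ?mulr0n ?mulr0 ?addr0.
  rewrite det_diag; apply: eq_bigr => k _.
  by rewrite !mxE -qD rmorphD rmorphM.
Qed.

End real_spectral.

Section determinant_bounds.
Context (R : realType) (n : nat).

(** Average the tangent inequality $e^{s}\ge e^m(1+s-m)$ at the mean [m]. *)
Lemma expR_jensen (I : finType) (p s : I -> R) : (forall i, 0 <= p i) ->
  \sum_i p i = 1 -> expR (\sum_i p i * s i) <= \sum_i p i * expR (s i).
Proof.
move=> p0 p1; set m := \sum_i p i * s i.
apply: (@le_trans _ _ (\sum_i p i * (expR m * (1 + (s i - m))))); last first.
  apply: ler_sum => i _; apply: ler_wpM2l => //.
  have -> : expR (s i) = expR m * expR (s i - m) by rewrite -expRD addrC subrK.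
  by rewrite ler_wpM2l ?expR_ge0// expR_ge1Dx.
have -> : \sum_i p i * (expR m * (1 + (s i - m))) =
    expR m * (1 - m) * \sum_i p i + expR m * m.
  rewrite -[X in _ + expR m * X]/(\sum_i p i * s i) !mulr_sumr -big_split/=.
  by apply: eq_bigr => i _; ring.
by rewrite p1 mulr1 -mulrDr subrK mulr1.
Qed.

(* The diagonal entries in an eigenbasis of the sum are convex combinations of the
   [expR (s i)], to which Jensen's inequality applies. *)
Lemma det_sum_ge (I : finType) (c s : I -> R) (u : I -> 'rV[R]_n) :
  (forall i, 0 <= c i) -> (forall i, \tr ((u i)^T *m u i) = 1) ->
  \sum_i c i *: ((u i)^T *m u i) = 1%:M ->
  expR (\sum_i c i * s i) <= \det (\sum_i (c i * expR (s i)) *: ((u i)^T *m u i)).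
Proof.
move=> c0 u1 cu; set M := \sum_i (c i * _) *: _.
have Msym : M^T = M.
  rewrite /M raddf_sum/=; apply: eq_bigr => i _.
  by rewrite linearZ/= trmx_mul trmxK.
have [q [q0 q1 qtr qdet]] := real_spectral Msym.
have -> : \det M = \prod_k q k M.
  have := qdet 0 1; rewrite scale1r raddf0 add0r => ->.
  by apply: eq_bigr => k _; rewrite add0r mul1r.
(* Each [(u i)^T *m u i] has trace one, so its diagonal entries split the weight [c i] among the
   eigenvectors. *)
have -> : \sum_i c i * s i = \sum_k \sum_i c i * q k ((u i)^T *m u i) * s i.
  rewrite exchange_big/=; apply: eq_bigr => i _.
  by rewrite -mulr_suml -mulr_sumr qtr u1 mulr1.
rewrite expR_sum; apply: ler_prod => k _; rewrite expR_ge0/=.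
apply: (@le_trans _ _ (\sum_i c i * q k ((u i)^T *m u i) * expR (s i))).
  apply: expR_jensen => [i|]; first exact: mulr_ge0.
  rewrite -(q1 k) -cu raddf_sum/=; apply: eq_bigr => i _.
  by rewrite linearZ.
rewrite /M raddf_sum/=; apply: ler_sum => i _.
by rewrite linearZ/= mulrAC.
Qed.

(** For an eigenvalue $x$ of $dH$ with $|x|\le 1/2$, $\ln(1+x)\ge x/(1+x)\ge x-2x^2$; summed over
    the eigenvalues this is $d\,\mathrm{tr}\,H-2d^2S$. *)
Lemma det_1D_gt1 (H : 'M[R]_n) : H^T = H -> 0 < \tr H ->
  exists2 d0 : R, 0 < d0 & forall d, 0 < d <= d0 -> 1 < \det (1%:M + d *: H).
Proof.
move=> Hsym trH; have [q [_ _ qtr qdet]] := real_spectral Hsym.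
pose S := \sum_k (q k H) ^+ 2.
have S0 : 0 <= S by apply: sumr_ge0 => k _; exact: sqr_ge0.
have S1 : 0 < 1 + S by lra.
(* The first bound gives $|x|\le 1/2$, because $2|t|\le 1+t^2\le 1+S$ for each eigenvalue $t$ of
   [H]; the second gives $2dS<\mathrm{tr}\,H$. *)
exists (Num.min (1 + S)^-1 (\tr H / (2 * (1 + S)) / 2)).
  by rewrite lt_min invr_gt0 S1 !divr_gt0// mulr_gt0.
move=> d /andP[d0]; rewrite le_min => /andP[d1 d2].
have dS : d * (1 + S) <= 1 by rewrite -ler_pdivlMr// div1r.
have dtr : 2 * d * S < \tr H.
  move: d2; rewrite -mulrA -invfM ler_pdivlMr; last by lra.
  have : 0 <= d * S by rewrite mulr_ge0// ltW.
  by nra.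
have qS k : q k H ^+ 2 <= S.
  by rewrite /S (bigD1 k)//= lerDl; apply: sumr_ge0 => j _; exact: sqr_ge0.
have dq k : `|d * q k H| <= 1 / 2.
  rewrite normrM gtr0_norm//.
  have : 2 * `|q k H| <= 1 + S.
    have := qS k; rewrite -real_normK ?num_real//; have := sqr_ge0 (`|q k H| - 1).
    by nra.
  by have := normr_ge0 (q k H); nra.
rewrite qdet.
apply: (@lt_le_trans _ _ (expR (\sum_k d * (q k H - 2 * d * q k H ^+ 2)))).
  rewrite expR_gt1 -mulr_sumr mulr_gt0// sumrB qtr -mulr_sumr subr_gt0.
  by rewrite -/S.
rewrite expR_sum; apply: ler_prod => k _; rewrite expR_ge0/=.
have := dq k; rewrite ler_norml; set x := d * q k H => /andP[x1 x2].
have x0 : 0 < 1 + x by lra.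
apply: (@le_trans _ _ (expR (x / (1 + x)))).
  rewrite ler_expR ler_pdivlMr//.
  have -> : d * (q k H - 2 * d * q k H ^+ 2) = x - 2 * x ^+ 2 by rewrite /x; ring.
  by nra.
rewrite -[leLHS]invrK -expRN invf_ple ?posrE ?invr_gt0 ?expR_gt0//.
apply: le_trans (expR_ge1Dx _); rewrite le_eqVlt; apply/orP; left; apply/eqP.
by field; rewrite gt_eqF.
Qed.

End determinant_bounds.

(** * John's decomposition *)

Section continuity.
Context (R : realType).

Lemma continuous_bigsum (T : topologicalType) (I : Type) (r : seq I)
    (f : I -> T -> R) : (forall i, continuous (f i)) ->
  continuous (fun x => \sum_(i <- r) f i x).
Proof.
move=> cf; elim: r => [|i r IH] x.
  by under eq_fun do rewrite big_nil; exact: cvg_cst.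
under eq_fun do rewrite big_cons.
by apply: cvgD; [exact: cf|exact: IH].
Qed.

Lemma continuousMR (T : topologicalType) (f g : T -> R) :
  continuous f -> continuous g -> continuous (fun x => f x * g x).
Proof. by move=> cf cg x; apply: cvgM; [exact: cf|exact: cg]. Qed.

Lemma continuousBR (T : topologicalType) (f g : T -> R) :
  continuous f -> continuous g -> continuous (fun x => f x - g x).
Proof. by move=> cf cg x; apply: cvgB; [exact: cf|exact: cg]. Qed.

Lemma continuous_rv (T : topologicalType) n (f : T -> 'rV[R]_n) :
  (forall j, continuous (fun x => f x ord0 j)) -> continuous f.
Proof.
move=> cf x; apply/cvgrPdist_le => e e0.
have : \forall t \near x, forall j, `|f x ord0 j - f t ord0 j| <= e.
  apply: filter_forall => j.
  by have /cvgrPdist_le := cf j x; apply.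
apply: filterS => t ft; apply: rv_norm_le; first exact: ltW.
by move=> j; rewrite !mxE.
Qed.

Lemma closed_leR (T : topologicalType) (f g : T -> R) :
  continuous f -> continuous g -> closed [set x | f x <= g x].
Proof.
move=> cf cg; rewrite (_ : mkset _ = (fun x => g x - f x) @^-1` [set y | 0 <= y]).
  apply: closed_comp; last exact: closed_ge.
  by move=> x _; apply: cvgB; [exact: cg|exact: cf].
by apply/seteqP; split => x /=; rewrite subr_ge0.
Qed.

End continuity.

(** The first-order condition for a quadratic minimal at the left end of its interval; it is the
    form in which all minimality arguments below are used. *)
Lemma first_order (R : realFieldType) (a b c : R) : (forall e, 0 < e <= 1 -> a <= a + 2 * e * b + e ^+ 2 * c) ->
  0 <= b.
Proof.
move=> h; rewrite leNgt; apply/negP => b0.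
have c1 : 0 < `|c| + 1 by rewrite ltr_wpDl.
pose e := Num.min 1 (- b / (`|c| + 1)).
have e0 : 0 < e by rewrite lt_min ltr01 divr_gt0// oppr_gt0.
have e1 : e <= 1 by rewrite ge_min lexx.
have eb : e * (`|c| + 1) <= - b by rewrite -ler_pdivlMr// ge_min lexx orbT.
have := h e; rewrite e0 e1 => /(_ isT).
rewrite -addrA lerDl expr2 => h1.
have : 0 <= e * (2 * b + e * c) by move: h1; congr (0 <= _); ring.
rewrite pmulr_rge0// => h2.
have : e * c <= e * `|c| by rewrite ler_wpM2l ?ler_norm// ltW.
by nra.
Qed.

(** * Projection of the identity on a cone of Gram matrices *)

Section cone.
Context (R : realType) (n : nat) (C : set 'rV[R]_n).
Hypothesis clC : closed C.
Hypothesis C0 : C 0.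
Hypothesis CZ : forall s v, 0 <= s -> C v -> C (s *: v).

Let rowsC m (V : 'M[R]_(m, n)) := forall i, C (row i V).
Let gram m (V : 'M[R]_(m, n)) := V^T *m V.

Let gramE m (V : 'M[R]_(m, n)) : gram V = \sum_i (row i V)^T *m row i V.
Proof.
apply/matrixP => j k; rewrite summxE mxE; apply: eq_bigr => i _.
by rewrite !mxE big_ord1 !mxE.
Qed.

(* One step of Caratheodory's theorem for the cone spanned by the [v^T v]. *)
Let free_row m (V : 'M[R]_(m, n)) : (n * n < m)%N -> rowsC V ->
  exists2 V' : 'M[R]_(m, n), rowsC V' & gram V' = gram V /\ exists i, row i V' = 0.
Proof.
move=> nm VC.
(* More than $n^2$ matrices of size $n$ are linearly dependent. *)
pose W : 'M[R]_(m, n * n) := \matrix_i mxvec ((row i V)^T *m row i V).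
have [a a0 aW] : exists2 a : 'rV_m, a != 0 & a *m W = 0.
  apply: contrapT => h; have : row_free W.
    apply: inj_row_free => v vW; apply/eqP/negPn/negP => v0; apply: h.
    by exists v.
  by rewrite /row_free => /eqP e; have := rank_leq_col W; rewrite e leqNgt nm.
have aV : \sum_i a 0 i *: ((row i V)^T *m row i V) = 0.
  apply: (can_inj mxvecK); rewrite raddf_sum/= linear0 -[RHS]aW mulmx_sum_row.
  by apply: eq_bigr => i _; rewrite linearZ/= rowK.
wlog [j aj] : a a0 aW aV / exists j, 0 < a 0 j.
  move=> wl; have /rV0Pn[j aj] := a0; have [aj0|aj0|/eqP] := ltgtP (a 0 j) 0.
  - apply: (wl (- a)); rewrite ?oppr_eq0 ?mulNmx ?aW ?oppr0//.
    + rewrite -[RHS]oppr0 -[in RHS]aV -sumrN; apply: eq_bigr => i _.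
      by rewrite mxE scaleNr.
    + by exists j; rewrite mxE oppr_gt0.
  - by apply: (wl a) => //; exists j.
  - by rewrite (negbTE aj).
(* At a largest coefficient, the new weights $1-a_i/a_{i_0}$ stay nonnegative and the one at [i0]
   vanishes. Their square roots are then absorbed in the rows. *)
pose i0 := [arg max_(i > j) a 0 i]%O.
have amax i : a 0 i <= a 0 i0 by rewrite /i0; case: arg_maxP => // k _ ; exact.
have ai0 : 0 < a 0 i0 by exact: lt_le_trans (amax j).
pose b i := 1 - a 0 i / a 0 i0.
have b0 i : 0 <= b i by rewrite subr_ge0 ler_pdivrMr// mul1r.
exists (\matrix_i (Num.sqrt (b i) *: row i V)).
  by move=> i; rewrite rowK; apply: CZ => //; exact: sqrtr_ge0.
split; last by exists i0; rewrite rowK /b divff ?gt_eqF// subrr sqrtr0 scale0r.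
rewrite !gramE.
transitivity (\sum_i b i *: ((row i V)^T *m row i V)).
  apply: eq_bigr => i _; rewrite rowK -scalemxAr [(_ *: _)^T]linearZ/= -scalemxAl scalerA.
  by rewrite -expr2 sqr_sqrtr.
under eq_bigr do rewrite /b scalerBl scale1r mulrC -scalerA.
by rewrite sumrB -scaler_sumr aV scaler0 subr0.
Qed.

(** The squared Frobenius distance from [gram V] to the identity. *)
Let dist m (V : 'M[R]_(m, n)) := \tr ((1%:M - gram V)^T *m (1%:M - gram V)).

Let frobE (A B : 'M[R]_n) : \tr (A^T *m B) = \sum_j \sum_k A j k * B j k.
Proof.
rewrite exchange_big/=; apply: eq_bigr => k _; rewrite mxE.
by apply: eq_bigr => j _; rewrite mxE.
Qed.

Let frob_ge0 (A : 'M[R]_n) : 0 <= \tr (A^T *m A).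
Proof.
by rewrite frobE; apply: sumr_ge0 => j _; apply: sumr_ge0 => k _; rewrite -expr2 sqr_ge0.
Qed.

(** A matrix doing better than [0] has $(1-g_{jj})^2\le n$ for the diagonal entries of its Gram
    matrix, and $V_{ij}^2\le g_{jj}$; its entries are then at most $n+2$, and the minimum is taken
    over a compact set. *)
Let min_gram m : exists2 V : 'M[R]_(m, n), rowsC V &
  forall V' : 'M[R]_(m, n), rowsC V' -> dist V <= dist V'.
Proof.
pose V (x : 'rV[R]_(m * n)) : 'M[R]_(m, n) := vec_mx x.
have VE x i j : V x i j = x ord0 (mxvec_index i j) by rewrite mxE.
have cV i j : continuous (fun x => V x i j).
  rewrite (_ : (fun x => V x i j) = (fun x => x ord0 (mxvec_index i j))).
    exact: coord_continuous.
  by apply/funext => x; rewrite VE.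
pose B := n%:R + 2 : R.
pose A : set 'rV[R]_(m * n) := [set x | rowsC (V x)] `&` [set x | `|x| <= B].
have d0 : dist (0 : 'M[R]_(m, n)) = n%:R.
  by rewrite /dist /gram mulmx0 subr0 trmx1 mulmx1 mxtrace1.
have A0 : A 0.
  split; last by rewrite /= normr0 addr_ge0.
  by move=> i; rewrite /V linear0 row0.
have cA : compact A.
  apply: bounded_closed_compact.
    by exists B; split => [|M MM x [_ /= /le_trans]]; [exact: num_real|apply; exact: ltW].
  apply: closedI; last first.
    by apply: closed_leR; [exact: norm_continuous|exact: cst_continuous].
  rewrite (_ : mkset _ = \bigcap_i ((fun x => row i (V x)) @^-1` C)); last first.
    by apply/seteqP; split => x /= h i; [move=> _|]; apply: h.
  apply: closed_bigI => i _; apply: closed_comp => // x _.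
  by move: x; apply: continuous_rv => j; under eq_fun do rewrite mxE; exact: cV.
have cd : continuous (fun x => dist (V x)).
  rewrite (_ : (fun x => _) = fun x => \sum_j \sum_k
     ((j == k)%:R - \sum_i V x i j * V x i k) * ((j == k)%:R - \sum_i V x i j * V x i k)).
    apply: continuous_bigsum => j; apply: continuous_bigsum => k.
    have c1 : continuous (fun x => (j == k)%:R - \sum_i V x i j * V x i k : R).
      apply: continuousBR; first exact: cst_continuous.
      by apply: continuous_bigsum => i; exact: continuousMR.
    exact: continuousMR.
  apply/funext => x; rewrite /dist frobE; apply: eq_bigr => j _; apply: eq_bigr => k _.
  rewrite /gram; congr (_ * _); rewrite !mxE; congr (_ - _);
    by apply: eq_bigr => i _; rewrite !mxE.
have [x xA xmin] := EVT_min_rV (ex_intro _ 0 A0) cA (continuous_subspaceT cd).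
exists (V x); first by move: xA; rewrite inE => -[].
move=> V' V'C.
have [big|small] := leP (dist (0 : 'M[R]_(m, n))) (dist V').
  by apply: le_trans big; have := xmin 0; rewrite inE /V linear0; exact.
have -> : V' = V (mxvec V') by rewrite /V mxvecK.
apply: xmin; rewrite inE; split; first by rewrite /= /V mxvecK.
apply: rv_norm_le; first by rewrite addr_ge0.
move=> k; have [i j] := mxvec_indexP k.
rewrite mxvecE -ler_sqr ?nnegrE ?normr_ge0 ?addr_ge0// real_normK ?num_real//.
have Vij : V' i j ^+ 2 <= gram V' j j.
  rewrite mxE (bigD1 i)//= mxE -expr2 lerDl; apply: sumr_ge0 => l _.
  by rewrite mxE -expr2 sqr_ge0.
have gj : (1 - gram V' j j) ^+ 2 <= n%:R.
  rewrite -d0; apply: le_trans (ltW small); rewrite /dist frobE (bigD1 j)//= (bigD1 j)//=.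
  have -> : (1%:M - gram V') j j = 1 - gram V' j j by rewrite !mxE eqxx.
  rewrite -expr2 -addrA lerDl addr_ge0// sumr_ge0// => l _.
    by rewrite -expr2 sqr_ge0.
  by apply: sumr_ge0 => l' _; rewrite -expr2 sqr_ge0.
have n0 : 0 <= n%:R :> R by [].
by rewrite /B; nra.
Qed.

Let frob_expand (Z P : 'M[R]_n) (a : R) : Z^T = Z ->
  \tr ((Z + a *: P)^T *m (Z + a *: P)) =
  \tr (Z^T *m Z) + 2 * a * \tr (Z *m P) + a ^+ 2 * \tr (P^T *m P).
Proof.
move=> Zs; rewrite [(_ + _)^T]raddfD/= [(_ *: _)^T]linearZ/= Zs mulmxDl !mulmxDr.
rewrite -!scalemxAl -!scalemxAr scalerA !raddfD/= !mxtraceZ.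
have -> : \tr (P^T *m Z) = \tr (Z *m P).
  by rewrite -mxtrace_tr trmx_mul trmxK Zs.
by rewrite expr2; ring.
Qed.

(* [Z] is the residual of the projection of the identity on the cone of the Gram
   matrices [V^T V]; by [free_row], [n ^ 2 + 1] rows are enough and one of them is
   free to be varied. *)
Lemma cone_alternative :
  (exists m (V : 'M[R]_(m, n)), (forall i, C (row i V)) /\ V^T *m V = 1%:M) \/
  (exists Z : 'M[R]_n, [/\ Z^T = Z, 0 < \tr Z &
    forall v, C v -> \tr (Z *m (v^T *m v)) <= 0]).
Proof.
have [V0 V0C min0] := min_gram (n * n).+1.
have [V VC [gV [i0 Vi0]]] := free_row (ltnSn _) V0C.
have {min0} minV (V' : 'M[R]_((n * n).+1, n)) : rowsC V' -> dist V <= dist V'.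
  by move=> V'C; have -> : dist V = dist V0; [rewrite /dist gV|exact: min0].
pose Z := 1%:M - gram V.
have [Z0|Z0] := eqVneq Z 0.
  left; exists (n * n).+1, V; split => //.
  by apply/esym/eqP; rewrite -subr_eq0; apply/eqP.
right; exists Z.
have gs : (gram V)^T = gram V by rewrite /gram trmx_mul trmxK.
have Zs : Z^T = Z by rewrite /Z raddfB/= trmx1 gs.
(* Minimality tested against the rescaled matrix, whose Gram matrix is [(1 - e) *: gram V]. *)
have ZW : 0 <= \tr (Z *m gram V).
  apply: (@first_order _ (dist V) _ (\tr ((gram V)^T *m gram V))) => e /andP[e0 e1].
  have -> : dist V + 2 * e * \tr (Z *m gram V) + e ^+ 2 * \tr ((gram V)^T *m gram V) =
      dist (Num.sqrt (1 - e) *: V).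
    rewrite /dist -/Z -frob_expand//.
    have -> : gram (Num.sqrt (1 - e) *: V) = (1 - e) *: gram V.
      rewrite /gram -scalemxAr [(_ *: _)^T]linearZ/= -scalemxAl scalerA -expr2.
      by rewrite sqr_sqrtr// subr_ge0.
    by congr (\tr (_^T *m _)); rewrite scalerBl scale1r opprB addrA addrAC.
  by apply: minV => i; rewrite linearZ/=; apply: CZ => //; exact: sqrtr_ge0.
split => //.
  (* The identity is the sum of [Z] and [gram V]; the first term is positive because [Z] is
     nonzero. *)
  have -> : \tr Z = \tr (Z^T *m Z) + \tr (Z *m gram V).
    by rewrite Zs -raddfD/= -mulmxDr subrK mulmx1.
  rewrite ltr_wpDr// lt_neqAle frob_ge0 andbT; apply: contra_neq Z0.
  rewrite frobE => /esym/eqP; rewrite psumr_eq0; last first.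
    by move=> j _; apply: sumr_ge0 => k _; rewrite -expr2 sqr_ge0.
  move=> /allP h; apply/matrixP => j k; rewrite [RHS]mxE.
  have := h j (mem_index_enum _); rewrite /= psumr_eq0; last first.
    by move=> k' _; rewrite -expr2 sqr_ge0.
  by move=> /allP/(_ k (mem_index_enum _)) /=; rewrite -expr2 sqrf_eq0 => /eqP.
move=> v Cv; rewrite -oppr_ge0.
apply: (@first_order _ (dist V) _ (\tr ((v^T *m v)^T *m (v^T *m v)))) => e /andP[e0 e1].
(* Putting [Num.sqrt e *: v] in the free row adds [e *: (v^T *m v)] to the Gram matrix. *)
pose V' : 'M[R]_((n * n).+1, n) :=
  \matrix_i (if i == i0 then Num.sqrt e *: v else row i V).
have gV' : gram V' = gram V + e *: (v^T *m v).
  rewrite !gramE (bigD1 i0)//= [in RHS](bigD1 i0)//= Vi0 mulmx0 add0r addrC.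
  congr (_ + _); last first.
    rewrite rowK eqxx -scalemxAr [(_ *: _)^T]linearZ/= -scalemxAl scalerA -expr2.
    by rewrite sqr_sqrtr// ltW.
  by apply: eq_bigr => i ii0; rewrite rowK (negbTE ii0).
have -> : dist V + 2 * e * - \tr (Z *m (v^T *m v)) +
    e ^+ 2 * \tr ((v^T *m v)^T *m (v^T *m v)) = dist V'.
  rewrite /dist gV' opprD addrA -/Z -scaleNr frob_expand//.
  by rewrite sqrrN mulrN -mulNr -mulrN.
apply: minV => i; rewrite rowK; case: ifP => // _.
by apply: CZ => //; exact: sqrtr_ge0.
Qed.

End cone.

Section euclid.
Context (R : realType) (n : nat).
Implicit Types x y v : 'rV[R]_n.

Definition edot x y : R := (x *m y^T) 0 0.

Lemma edotE x y : edot x y = \sum_i x ord0 i * y ord0 i.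
Proof. by rewrite /edot mxE; apply: eq_bigr => i _; rewrite mxE. Qed.

Lemma edotC x y : edot x y = edot y x.
Proof. by rewrite !edotE; apply: eq_bigr => i _; rewrite mulrC. Qed.

Lemma edotDl x y z : edot (x + y) z = edot x z + edot y z.
Proof. by rewrite /edot mulmxDl mxE. Qed.

Lemma edotZl a x y : edot (a *: x) y = a * edot x y.
Proof. by rewrite /edot -scalemxAl mxE. Qed.

Lemma edotNl x y : edot (- x) y = - edot x y.
Proof. by rewrite -scaleN1r edotZl mulN1r. Qed.

Lemma edotDr x y z : edot z (x + y) = edot z x + edot z y.
Proof. by rewrite !(edotC z) edotDl. Qed.

Lemma edotZr a x y : edot x (a *: y) = a * edot x y.
Proof. by rewrite !(edotC x) edotZl. Qed.

Lemma edotNr x y : edot x (- y) = - edot x y.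
Proof. by rewrite !(edotC x) edotNl. Qed.

Lemma edot0l x : edot 0 x = 0.
Proof. by rewrite /edot mul0mx mxE. Qed.

Lemma edot_ge0 x : 0 <= edot x x.
Proof. by rewrite edotE; apply: sumr_ge0 => i _; rewrite -expr2 sqr_ge0. Qed.

Lemma edot_eq0 x : (edot x x == 0) = (x == 0).
Proof.
apply/eqP/eqP => [|->]; last exact: edot0l.
rewrite edotE => /eqP; rewrite psumr_eq0; last by move=> i _; rewrite -expr2 sqr_ge0.
move=> /allP h; apply/rowP => i; rewrite mxE.
by have := h i (mem_index_enum _); rewrite /= -expr2 sqrf_eq0 => /eqP.
Qed.

Lemma edot_trace x : \tr (x^T *m x) = edot x x.
Proof. by rewrite mxtrace_mulC /mxtrace big_ord1. Qed.

Lemma edot_mulmx x y (A : 'M[R]_n) : edot (x *m A) y = edot x (y *m A^T).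
Proof. by rewrite /edot trmx_mul trmxK mulmxA. Qed.

Lemma edot_quad (A : 'M[R]_n) x : \tr (A *m (x^T *m x)) = edot (x *m A) x.
Proof. by rewrite mulmxA mxtrace_mulC mulmxA /mxtrace big_ord1. Qed.

Lemma enormE x : enorm x = Num.sqrt (edot x x).
Proof. by rewrite /enorm edotE; congr Num.sqrt; apply: eq_bigr => i _; rewrite expr2. Qed.

Lemma enorm_sqr x : enorm x ^+ 2 = edot x x.
Proof. by rewrite enormE sqr_sqrtr// edot_ge0. Qed.

Lemma enorm_ge0 x : 0 <= enorm x.
Proof. exact: sqrtr_ge0. Qed.

Lemma enorm_le1 x : (enorm x <= 1) = (edot x x <= 1).
Proof. by rewrite -enorm_sqr -[X in _ = (_ <= X)](expr1n _ 2) ler_sqr ?nnegrE ?enorm_ge0. Qed.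

Lemma enorm_gt0 x : x != 0 -> 0 < enorm x.
Proof. by move=> x0; rewrite enormE sqrtr_gt0 lt_neqAle eq_sym edot_eq0 x0 edot_ge0. Qed.

Lemma enormZ a x : enorm (a *: x) = `|a| * enorm x.
Proof. by rewrite !enormE edotZl edotZr mulrA -expr2 sqrtrM ?sqr_ge0// sqrtr_sqr. Qed.

Lemma edot_subZ e x v : edot (x - e *: v) (x - e *: v) =
  edot x x + 2 * e * - edot v x + e ^+ 2 * edot v v.
Proof.
rewrite edotDl !edotDr !edotNl !edotNr !edotZl !edotZr (edotC x v).
by ring.
Qed.

Lemma edot_le1 x y : edot x x <= 1 -> edot y y <= 1 -> edot x y <= 1.
Proof.
move=> x1 y1; have := edot_ge0 (x - y).
by rewrite edotDl !edotDr !edotNl !edotNr (edotC y x); lra.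
Qed.

Lemma continuous_edot (T : topologicalType) (f g : T -> 'rV[R]_n) :
  continuous f -> continuous g -> continuous (fun t => edot (f t) (g t)).
Proof.
move=> cf cg; rewrite (_ : (fun t => _) = fun t => \sum_i f t ord0 i * g t ord0 i).
  apply: continuous_bigsum => i.
  have ch (h : T -> 'rV[R]_n) : continuous h -> continuous (fun t => h t ord0 i).
    move=> hc t; apply: (@continuous_comp _ _ _ h (fun z => z ord0 i)); first exact: hc.
    exact: coord_continuous.
  by apply: continuousMR; exact: ch.
by apply/funext => t; rewrite edotE.
Qed.

Lemma continuous_enorm : continuous (@enorm R n).
Proof.
rewrite (_ : @enorm R n = fun x => Num.sqrt (edot x x)); last first.
  by apply/funext => x; rewrite enormE.
move=> x; apply: (@continuous_comp _ _ _ (fun x => edot x x)); last exact: sqrt_continuous.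
by move: x; apply: continuous_edot => x; exact: cvg_id.
Qed.

Lemma continuous_mulmx (A : 'M[R]_n) : continuous (fun x : 'rV[R]_n => x *m A).
Proof.
apply: continuous_rv => j.
rewrite (_ : (fun x => _) = fun x : 'rV[R]_n => \sum_i x ord0 i * A i j).
  apply: continuous_bigsum => i; apply: continuousMR; first exact: coord_continuous.
  exact: cst_continuous.
by apply/funext => x; rewrite mxE.
Qed.

End euclid.

(** * The polar body and the contact directions *)

Section polar.
Context (R : realType) (n : nat) (K : set 'rV[R]_n).
Hypothesis cK : compact K.
Hypothesis vK : convex_set (K : set (convex_lmodType 'rV[R]_n)).
Hypothesis BK : unit_ball R n `<=` K.

Definition polar : set 'rV[R]_n := [set w | forall x, K x -> edot x w <= 1].

Lemma polar_le1 w : polar w -> edot w w <= 1.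
Proof.
move=> Pw; have [->|w0] := eqVneq w 0; first by rewrite edot0l.
have nw := enorm_gt0 w0.
have /BK/Pw : unit_ball R n ((enorm w)^-1 *: w).
  by rewrite /unit_ball/= enormZ gtr0_norm ?invr_gt0// mulVf// gt_eqF.
rewrite edotZl -enorm_sqr expr2 mulKf ?gt_eqF// => w1.
by rewrite mulr_ile1// ltW.
Qed.

Lemma compact_polar : compact polar.
Proof.
apply: bounded_closed_compact.
  exists 1; split => [|M M1 w /polar_le1 w1]; first exact: num_real.
  apply: rv_norm_le; first by apply: ltW; apply: lt_trans M1.
  move=> i; apply: le_trans (ltW M1).
  rewrite -ler_sqr ?nnegrE// expr1n real_normK ?num_real//; apply: le_trans w1.
  rewrite edotE (bigD1 i)//= -expr2 lerDl; apply: sumr_ge0 => j _.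
  by rewrite -expr2 sqr_ge0.
rewrite (_ : polar = \bigcap_(x in K) [set w | edot x w <= 1]); last first.
  by apply/seteqP; split => w /= h x Kx; exact: h.
apply: closed_bigI => x _; apply: closed_leR; last exact: cst_continuous.
by apply: continuous_edot => w; [exact: cst_continuous|exact: cvg_id].
Qed.

(** The nearest point [p] of [K] yields the separating direction [z = x - p]. The maximum [b] of
    [edot _ z] over [K], attained at [p], is positive because [K] contains the ball, so [z] can be
    divided by it. *)
Lemma bipolar x : ~ K x -> exists2 w, polar w & 1 < edot x w.
Proof.
move=> nKx.
have K0 : K 0 by apply: BK; rewrite /unit_ball/= enormE edot0l sqrtr0.
have cd : {within K, continuous (fun y => edot (x - y) (x - y))}.
  apply: continuous_subspaceT; apply: continuous_edot; apply: continuous_rv => j;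
    under eq_fun do rewrite !mxE; by apply: continuousBR; [exact: cst_continuous|exact: coord_continuous].
have [p Kp pmin] := EVT_min_rV (ex_intro _ 0 K0) cK cd.
move: Kp; rewrite inE => Kp.
pose z := x - p.
have z0 : z != 0 by rewrite subr_eq0; apply: contra_notN nKx => /eqP ->.
have zz : 0 < edot z z by rewrite lt_neqAle eq_sym edot_eq0 z0 edot_ge0.
(* First-order condition at [p] along the segment towards [y]. *)
have yp y : K y -> edot (y - p) z <= 0.
  move=> Ky; rewrite -oppr_ge0.
  apply: (@first_order _ (edot z z) _ (edot (y - p) (y - p))) => e /andP[e0 e1].
  have ei : 0 <= e <= 1 by rewrite ltW.
  have Kq : K (p + e *: (y - p)).
    have -> : p + e *: (y - p) = e *: y + (1 - e) *: p.
      by rewrite scalerBl scale1r scalerBr addrCA.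
    exact: set_mem (vK (Itv01 (ltW e0) e1) (mem_set Ky) (mem_set Kp)).
  have := pmin _ (mem_set Kq); rewrite -/z.
  have -> : x - (p + e *: (y - p)) = z - e *: (y - p) by rewrite opprD addrA.
  by rewrite edot_subZ.
pose b := edot p z.
have Kb y : K y -> edot y z <= b.
  by move=> /yp; rewrite edotDl edotNl subr_le0.
have b0 : 0 < b.
  have nz := enorm_gt0 z0.
  have /BK/Kb : unit_ball R n ((enorm z)^-1 *: z).
    by rewrite /unit_ball/= enormZ gtr0_norm ?invr_gt0// mulVf// gt_eqF.
  by rewrite edotZl -enorm_sqr expr2 mulKf ?gt_eqF//; exact: lt_le_trans.
exists (b^-1 *: z).
  by move=> y /Kb yb; rewrite edotZr mulrC ler_pdivrMr// mul1r.
rewrite edotZr mulrC ltr_pdivlMr// mul1r.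
by have := zz; rewrite {1}/z edotDl edotNl subr_gt0.
Qed.

End polar.

(** If [K] contains the unit ball, the nonzero elements are the positive multiples of the contact
    points: [v / |v|] then lies in [K] and on a supporting hyperplane. Leaving [v] unnormalised
    gives a closed cone, as [cone_alternative] requires. *)
Definition contact_cone (R : realType) n (K : set 'rV[R]_n) : set 'rV[R]_n :=
  [set v | forall x, K x -> edot x v <= enorm v].

Section contact_cone.
Context (R : realType) (n : nat) (K : set 'rV[R]_n).

Lemma closed_contact_cone : closed (contact_cone K).
Proof.
rewrite (_ : contact_cone K = \bigcap_(x in K) [set v | edot x v <= enorm v]); last first.
  by apply/seteqP; split => w /= h x Kx; exact: h.
apply: closed_bigI => x _; apply: closed_leR; last exact: continuous_enorm.
by apply: continuous_edot => w; [exact: cst_continuous|exact: cvg_id].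
Qed.

Lemma contact_cone0 : contact_cone K 0.
Proof. by move=> x _; rewrite edotC edot0l enorm_ge0. Qed.

Lemma contact_coneZ s v : 0 <= s -> contact_cone K v -> contact_cone K (s *: v).
Proof. by move=> s0 Cv x Kx; rewrite edotZr enormZ ger0_norm// ler_wpM2l// Cv. Qed.

End contact_cone.

Section ball_volume.
Context (R : realType) (n : nat).

Lemma measurable_edot (A : 'M[R]_n) :
  measurable_fun setT (fun x : 'rV[R]_n => edot (x *m A) (x *m A)).
Proof.
rewrite (_ : (fun x => _) = fun x => \sum_i (x *m A) ord0 i * (x *m A) ord0 i); last first.
  by apply/funext => x; rewrite edotE.
apply: measurable_sum => i.
have mA : measurable_fun setT (fun x : 'rV[R]_n => (x *m A) ord0 i).
  apply: (measurableT_comp (@measurable_coor R n i)).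
  by have := measurable_affine A 0; under eq_fun do rewrite addr0.
exact: measurable_funM.
Qed.

Lemma measurable_ball_image (A : 'M[R]_n) :
  measurable [set x : 'rV[R]_n | enorm (x *m A) <= 1].
Proof.
rewrite (_ : mkset _ = (fun x : 'rV[R]_n => edot (x *m A) (x *m A)) @^-1` `]-oo, 1]%classic).
  by rewrite -[X in measurable X]setTI; apply: measurable_edot.
by apply/seteqP; split => x /=; rewrite enorm_le1 in_itv.
Qed.

Lemma measurable_unit_ball : measurable (unit_ball R n).
Proof. by have := measurable_ball_image 1%:M; under eq_set do rewrite mulmx1. Qed.

Lemma leb_unit_ball_gt0 : (0 < leb R n (unit_ball R n))%E.
Proof.
have r0 : 0 < (n.+1%:R)^-1 :> R by rewrite invr_gt0.
(* In this cube the [n] squared coordinates are each at most $1/(n+1)$. *)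
apply: (@lt_le_trans _ _ (leb R n (half_cube 0 (n.+1%:R)^-1))).
  by rewrite leb_half_cube ?ltW// lte_fin exprn_gt0.
apply: le_measure; rewrite ?inE; [exact: measurable_half_cube|exact: measurable_unit_ball|].
move=> x xc; rewrite /unit_ball/= enorm_le1 edotE.
apply: (@le_trans _ _ (\sum_(i < n) (n.+1%:R)^-1)).
  apply: ler_sum => i _; have := xc i; rewrite mxE add0r => /andP[x0 xr].
  apply: (@le_trans _ _ (x ord0 i * 1)); last by rewrite mulr1 ltW.
  by rewrite ler_wpM2l// (le_trans (ltW xr))// invf_le1// ler1n.
rewrite sumr_const card_ord -[X in X <= _]mulr_natl ler_pdivrMr// mul1r ler_nat.
exact: leqnSn.
Qed.

Lemma leb_unit_ball_lty : (leb R n (unit_ball R n) < +oo)%E.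
Proof.
(* Side 3 rather than 2, since the half-open cube has to contain the points with a coordinate equal
   to 1. *)
apply: (@le_lt_trans _ _ (leb R n (half_cube (const_mx (-1)) 3))).
  apply: le_measure; rewrite ?inE; [exact: measurable_unit_ball|exact: measurable_half_cube|].
  move=> x; rewrite /unit_ball/= enorm_le1 edotE => x1 i; rewrite mxE.
  have : x ord0 i ^+ 2 <= 1.
    apply: le_trans x1; rewrite (bigD1 i)//= -expr2 lerDl; apply: sumr_ge0 => j _.
    by rewrite -expr2 sqr_ge0.
  by move=> ?; apply/andP; split; nra.
by rewrite leb_half_cube// ltry.
Qed.

Lemma leb_ball_image (A : 'M[R]_n) : A \in unitmx ->
  leb R n [set 0 + x *m A | x in unit_ball R n] =
    (`|\det A|%:E * leb R n (unit_ball R n))%E.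
Proof.
move=> uA.
have uA' : invmx A \in unitmx by rewrite unitmx_inv.
rewrite -(@leb_preimage_affine _ _ (invmx A) 0 _ uA' measurable_unit_ball).
rewrite muleA -EFinM -normrM -det_mulmx mulmxV// det1 normr1 mul1e; congr (leb R n _).
apply/seteqP; split => y /=; rewrite ?addr0.
  by move=> [x xB <-]; rewrite add0r mulmxK.
by move=> yB; exists (y *m invmx A) => //; rewrite add0r mulmxKV.
Qed.

End ball_volume.

(* The weights of John's decomposition are absorbed in the vectors: the rows
   [v_i] of [V] are [sqrt c_i u_i] for contact points [u_i].  If there is no
   such [V], the separating [Z] gives a symmetric [H] of positive trace which is
   negative definite in every contact direction, and [1 + d H] maps the ball into
   [K] and increases its volume when [d] is small. *)
Lemma john_decomposition (R : realType) n (K : set 'rV[R]_n) :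
  convex_body K -> john_position K ->
  exists m (V : 'M[R]_(m, n)), (forall i, contact_cone K (row i V)) /\ V^T *m V = 1%:M.
Proof.
move=> [K0 cK vK] [_ BK Bmax].
case: (cone_alternative (@closed_contact_cone _ _ K) (@contact_cone0 _ _ K)
  (@contact_coneZ _ _ K)) => // -[Z [Zs Z0 ZC]]; exfalso.
have n0 : 0 < n%:R :> R.
  rewrite ltr0n lt0n; apply/negP => /eqP n0; subst n.
  by move: Z0; rewrite /mxtrace big_ord0 ltxx.
(* Removing half of the mean eigenvalue leaves trace $\mathrm{tr}\,Z/2>0$ and makes the form at most
   [- eta] at unit vectors of the polar. *)
pose eta := \tr Z / (2 * n%:R).
have eta0 : 0 < eta by rewrite divr_gt0// mulr_gt0.
pose H := Z - eta%:M.
have Hs : H^T = H by rewrite /H raddfB/= tr_scalar_mx Zs.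
have trH : 0 < \tr H.
  rewrite raddfB/= mxtrace_scalar -mulr_natr /eta.
  rewrite (_ : _ - _ = \tr Z / 2); first by rewrite divr_gt0.
  by field; rewrite gt_eqF.
have HE w : edot (w *m H) w = edot (w *m Z) w - eta * edot w w.
  by rewrite mulmxBr edotDl edotNl mul_mx_scalar edotZl.
have PH w : polar K w -> edot w w = 1 -> edot (w *m H) w <= - eta.
  move=> Pw w1; rewrite HE w1 mulr1; have := ZC w; rewrite edot_quad => h.
  suff : edot (w *m Z) w <= 0 by lra.
  by apply: h => x Kx; rewrite enormE w1 sqrtr1; exact: Pw.
have cP := compact_polar BK.
have cH : continuous (fun w : 'rV[R]_n => edot (w *m H) w).
  by apply: continuous_edot; [exact: continuous_mulmx|move=> w; exact: cvg_id].
have cw : continuous (fun w : 'rV[R]_n => edot w w).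
  by apply: continuous_edot => w; exact: cvg_id.
have cHH : continuous (fun w : 'rV[R]_n => edot (w *m H) (w *m H)).
  by apply: continuous_edot; exact: continuous_mulmx.
(* The points of the polar where the form of [H] is not clearly negative. None of them is a unit
   vector, so by compactness their squared norms stay below some [m < 1]. *)
pose A := polar K `&` [set w | - (eta / 2) <= edot (w *m H) w].
have cA : compact A.
  apply: (subclosed_compact _ cP); last by move=> w [].
  apply: closedI; first exact: compact_closed.
  by apply: closed_leR => //; exact: cst_continuous.
have [m m1 Am] : exists2 m, m < 1 & forall w, A w -> edot w w <= m.
  have [A0|A0] := pselect (A !=set0); last first.
    by exists 0 => // w Aw; exfalso; apply: A0; exists w.
  have [w wA wmax] := EVT_max_rV A0 cA (continuous_subspaceT cw).
  exists (edot w w); last by move=> v Av; apply: wmax; rewrite inE.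
  move: wA; rewrite inE => -[Pw /= wH].
  rewrite lt_neqAle (polar_le1 BK Pw) andbT; apply/eqP => w1.
  by have := PH w Pw w1; move: eta0 wH; lra.
have P0 : polar K !=set0 by exists 0 => x _; rewrite edotC edot0l.
have [w1 _ max1] := EVT_max_rV P0 cP (continuous_subspaceT cH).
have [w2 _ max2] := EVT_max_rV P0 cP (continuous_subspaceT cHH).
pose B1 := `|edot (w1 *m H) w1|.
pose B2 := edot (w2 *m H) (w2 *m H).
have B10 : 0 <= B1 by exact: normr_ge0.
have B20 : 0 <= B2 by exact: edot_ge0.
have hB1 w : polar K w -> edot (w *m H) w <= B1.
  by move=> Pw; apply: le_trans (ler_norm _); apply: max1; rewrite inE.
have hB2 w : polar K w -> edot (w *m H) (w *m H) <= B2.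
  by move=> Pw; apply: max2; rewrite inE.
have [d0 d0_gt0 hd0] := det_1D_gt1 Hs trH.
(* In [shrink], the third bound keeps the growth on [A] within the slack [1 - m]; the last one lets
   the first-order loss outside [A] absorb the second-order term. *)
pose d := Num.min (Num.min d0 1) (Num.min ((1 - m) / (2 * B1 + B2 + 1)) (eta / (B2 + 1))).
have d_gt0 : 0 < d by rewrite !lt_min d0_gt0 ltr01/= !divr_gt0//; lra.
have dd0 : d <= d0 by rewrite /d !ge_min lexx.
have d1 : d <= 1 by rewrite /d !ge_min lexx orbT.
have dm : d * (2 * B1 + B2 + 1) <= 1 - m.
  by rewrite -ler_pdivlMr; [rewrite /d !ge_min lexx !orbT|lra].
have de : d * (B2 + 1) <= eta.
  by rewrite -ler_pdivlMr; [rewrite /d !ge_min lexx !orbT|lra].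
have Ew w : edot (w + d *: (w *m H)) (w + d *: (w *m H)) =
    edot w w + 2 * d * edot (w *m H) w + d ^+ 2 * edot (w *m H) (w *m H).
  by rewrite -[d *: _]opprK -scaleNr edot_subZ; ring.
have shrink w : polar K w -> edot (w + d *: (w *m H)) (w + d *: (w *m H)) <= 1.
  move=> Pw; rewrite Ew.
  have h2 : d ^+ 2 * edot (w *m H) (w *m H) <= d * (d * B2).
    by rewrite expr2 -mulrA !ler_pM2l// hB2.
  have h2' : d * (d * B2) <= d * B2 by rewrite ler_pM2l//; nra.
  have [wA|wA] := leP (- (eta / 2)) (edot (w *m H) w).
    have := Am w (conj Pw wA); have : d * edot (w *m H) w <= d * B1 by rewrite ler_pM2l// hB1.
    by lra.
  have : d * edot (w *m H) w <= d * (- (eta / 2)) by rewrite ler_pM2l// ltW.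
  have := polar_le1 BK Pw.
  have : d * (d * (B2 + 1)) <= d * eta by rewrite ler_pM2l.
  by have := mulr_gt0 d_gt0 d_gt0; lra.
pose M := 1%:M + d *: H.
have detM : 1 < \det M by apply: hd0; rewrite d_gt0.
have uM : M \in unitmx by rewrite unitmxE unitfE gt_eqF// (lt_trans ltr01).
have Ms : M^T = M by rewrite /M raddfD/= [(_ *: _)^T]linearZ/= Hs trmx1.
pose E := [set 0 + x *m M | x in unit_ball R n].
(* By duality: for [w] in the polar, [edot (x *m M) w = edot x (w *m M)], and [shrink] puts [w *m M]
   in the unit ball. *)
have EK : E `<=` K.
  move=> _ [x xB <-]; rewrite add0r; apply: contrapT => /(bipolar cK vK BK)[w Pw].
  apply/negP; rewrite -leNgt edot_mulmx Ms /M mulmxDr mulmx1 -scalemxAr.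
  by apply: edot_le1; [rewrite -enorm_le1|exact: shrink].
have := Bmax E (ex_intro _ 0 (ex_intro _ M (conj uM erefl))) EK.
rewrite !volE leb_ball_image// leNgt => /negP; apply.
have := leb_unit_ball_gt0 R n; have := leb_unit_ball_lty R n.
case: (leb R n (unit_ball R n)) => [b| |]// _; rewrite lte_fin => b0.
by rewrite -EFinM lte_fin ltr_pMl// (lt_le_trans detM)// ler_norm.
Qed.

(** * One-dimensional transport *)

Section cumulative.
Context (R : realType).
Local Notation mu := (@lebesgue_measure R).
Variables (w : R -> R) (c : R).
Hypothesis cw : continuous w.
Hypothesis w0 : forall x, 0 < w x.
Hypothesis iw : (\int[mu]_x (w x)%:E = c%:E)%E.

Definition cumul (s : R) : R := (\int[mu]_(x in `]-oo, s]) w x)%R.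

Let mw : measurable_fun setT w.
Proof. exact: continuous_measurable_fun. Qed.

Let mwE D : measurable D -> measurable_fun D (EFin \o w).
Proof. by move=> mD; apply/measurable_EFinP; exact: measurable_funTS. Qed.

Let intw (D : set R) : measurable D -> mu.-integrable D (EFin \o w).
Proof.
move=> mD; apply: (@integrableS _ _ _ mu setT) => //.
apply/integrableP; split; first exact: mwE.
under eq_integral => x _ do rewrite /= ger0_norm ?ltW//.
by rewrite iw ltry.
Qed.

Lemma cumulE s : ((cumul s)%:E = \int[mu]_(x in `]-oo, s]) (w x)%:E)%E.
Proof. by rewrite /cumul /Rintegral fineK//; apply: integrable_fin_num => //; exact: intw. Qed.

Lemma cumul_is_derive (s : R) : is_derive s 1 cumul (w s).
Proof.
have s1 : s < s + 1 by rewrite ltrDl.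
have [d1 d2] := @continuous_FTC1 R w -oo%O s (s + 1) s1 (intw (measurable_itv _)) (ltNyr _) (@cw s).
by apply: DeriveDef => //; rewrite -derive1E.
Qed.

Lemma cumul_lt s t : s < t -> cumul s < cumul t.
Proof.
move=> st; have [||u _ e] := @MVT R cumul w s t st.
- by move=> x _; exact: cumul_is_derive.
- apply: derivable_within_continuous => x _.
  by have [] := cumul_is_derive x.
- by rewrite -subr_gt0 e mulr_gt0// subr_gt0.
Qed.

Lemma cumulC s : (c%:E - (cumul s)%:E = \int[mu]_(x in `]s, +oo[) (w x)%:E)%E.
Proof.
rewrite cumulE -iw.
have -> : [set: R] = `]-oo, s]%classic `|` `]s, +oo[%classic.
  apply/seteqP; split => // x _ /=; rewrite !in_itv/= andbT.
  by have [|] := leP x s; [left|right].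
rewrite ge0_integral_setU//=.
- by rewrite addeAC subee ?add0e// -cumulE.
- by apply: mwE; exact: measurableU.
- by move=> x _; rewrite lee_fin ltW.
- rewrite disj_set2E; apply/eqP; rewrite -subset0 => x [] /=; rewrite !in_itv/= andbT.
  by move=> xs; rewrite ltNge xs.
Qed.

Lemma cumul_gt0 s : 0 < cumul s.
Proof.
apply: le_lt_trans (cumul_lt (_ : s - 1 < s)); last by rewrite ltrBlDr ltrDl.
by rewrite -lee_fin cumulE; apply: integral_ge0 => x _; rewrite lee_fin ltW.
Qed.

Lemma cumul_ltc s : cumul s < c.
Proof.
apply: lt_le_trans (cumul_lt (_ : s < s + 1)) _; first by rewrite ltrDl.
rewrite -subr_ge0 -lee_fin EFinB cumulC; apply: integral_ge0 => x _.
by rewrite lee_fin ltW.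
Qed.

(** Monotone convergence: an exhausting sequence eventually carries more mass than any [y < c]. *)
Let cvg_sets (F : nat -> set R) : nondecreasing_seq F -> (forall k, measurable (F k)) ->
  \bigcup_k F k = setT -> forall y, y < c ->
  exists k, (y%:E < \int[mu]_(x in F k) (w x)%:E)%E.
Proof.
move=> ndF mF FT y yc.
have H : (\int[mu]_(x in F i) (EFin \o w) x @[i --> \oo] -->
    \int[mu]_(x in \bigcup_i F i) (EFin \o w) x)%E.
  apply: ge0_nondecreasing_set_cvg_integral => //.
  - by move=> k; exact: mwE.
  - by move=> k x _; rewrite lee_fin ltW.
apply: contrapT => /forallNP nk.
have : (\int[mu]_(x in \bigcup_i F i) (EFin \o w) x <= y%:E)%E.
  rewrite -(cvg_lim _ H)//; apply: lime_le; first by apply/cvg_ex; eexists; exact: H.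
  by near=> k; rewrite leNgt; apply/negP; exact: nk.
by rewrite FT iw lee_fin leNgt yc.
Unshelve. all: by end_near. Qed.

Lemma cumul_inv y : 0 < y < c -> exists s, cumul s = y.
Proof.
move=> /andP[y0 yc].
have [k] : exists k : nat, (y%:E < \int[mu]_(x in `]-oo, k%:R]) (w x)%:E)%E.
  apply: (@cvg_sets (fun k => `]-oo, k%:R]%classic)) => //.
  - by move=> i j ij; apply/subsetPset => x /=; rewrite !in_itv/= => /le_trans; apply; rewrite ler_nat.
  - apply/seteqP; split => // x _; exists (Num.truncn `|x|).+1 => //=.
    by rewrite in_itv/= (le_trans (ler_norm x))// ltW// truncnS_gt.
rewrite -cumulE lte_fin => yk.
(* A right tail of mass more than [c - y] leaves less than [y] to its left, which is the lower end
   for the intermediate value theorem. *)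
have [j] : exists j : nat, ((c - y)%:E < \int[mu]_(x in `](- j%:R)%R, +oo[) (w x)%:E)%E.
  apply: (@cvg_sets (fun k => `]- k%:R, +oo[%classic)) => //.
  - by move=> i j ij; apply/subsetPset => x /=; rewrite !in_itv/= !andbT; apply: le_lt_trans; rewrite lerN2 ler_nat.
  - apply/seteqP; split => // x _; exists (Num.truncn `|x|).+1 => //=.
    by have := truncnS_gt `|x|; rewrite ltr_norml in_itv/= andbT => /andP[].
  by rewrite ltrBlDr ltrDl.
rewrite -cumulC -EFinB lte_fin => yj0; have yj : cumul (- j%:R) < y by lra.
have kj : - j%:R <= k%:R :> R by rewrite (@le_trans _ _ 0)// oppr_le0.
have cc : {within `[- j%:R, k%:R], continuous cumul}.
  by apply: derivable_within_continuous => x _; have [] := cumul_is_derive x.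
have [|s _ <-] := IVT kj cc (_ : _ <= y <= _); last by exists s.
by rewrite ge_min le_max (ltW yj) (ltW yk) orbT.
Qed.

End cumulative.

Section one_dimensional.
Context (R : realType).
Local Notation mu := (@lebesgue_measure R).

Definition gauss (t : R) : R := expR (- (pi * t ^+ 2)).

Definition slab_dist (t : R) : R := Num.max (`|t| - 1) 0.

(** The function $f$ of the overview; [slab_dist] is the distance to $[-1,1]$. *)
Definition slab_weight (t : R) : R := expR (- (pi * slab_dist t ^+ 2)).

Lemma continuous_gauss : continuous gauss.
Proof.
move=> x; apply: (@continuous_comp _ _ _ (fun t : R => - (pi * t ^+ 2)) expR).
  by apply: cvgN; apply: cvgM; [exact: cst_continuous|exact: exprn_continuous].
exact: continuous_expR.
Qed.

Lemma continuous_slab_dist : continuous slab_dist.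
Proof.
move=> x; rewrite (_ : slab_dist = (fun t => `|t| - 1) \max (fun=> 0)) //.
apply: continuous_max; last exact: cst_continuous.
by apply: cvgB; [exact: norm_continuous|exact: cst_continuous].
Qed.

Lemma continuous_slab_weight : continuous slab_weight.
Proof.
move=> x; apply: (@continuous_comp _ _ _ slab_dist gauss); first exact: continuous_slab_dist.
exact: continuous_gauss.
Qed.

Lemma gauss_gt0 t : 0 < gauss t. Proof. exact: expR_gt0. Qed.

Lemma slab_weight_gt0 t : 0 < slab_weight t. Proof. exact: expR_gt0. Qed.

Lemma integral_gauss : (\int[mu]_x (gauss x)%:E = 1)%E.
Proof.
have p0 : 0 < Num.sqrt (pi : R) by rewrite sqrtr_gt0 pi_gt0.
have mg : measurable_fun setT (EFin \o @gauss_fun R).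
  by apply/measurable_EFinP; exact: measurable_gauss_fun.
have := @integral_lebesgue_affine R (Num.sqrt pi) 0 _ (lt0r_neq0 p0) mg.
move=> /(_ (fun=> gauss_fun_ge0 _)); rewrite /= integralT_gauss gtr0_norm//.
have -> : (\int[mu]_t (gauss_fun (Num.sqrt pi * t + 0))%:E = \int[mu]_x (gauss x)%:E)%E.
  apply: eq_integral => t _; rewrite /gauss_fun/= addr0 exprMn sqr_sqrtr //; exact: pi_ge0.
move=> /(congr1 (fun z => (Num.sqrt pi)^-1%:E * z)%E).
by rewrite muleA -!EFinM (mulVf (lt0r_neq0 p0)) mul1e.
Qed.

Lemma integral_shift (b : R) (A : set R) (phi : R -> \bar R) : measurable A ->
  measurable_fun setT phi -> (forall x, 0 <= phi x)%E ->
  (\int[mu]_(x in (fun t => t + b)%R @^-1` A) phi (x + b)%R = \int[mu]_(x in A) phi x)%E.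
Proof.
move=> mA mphi phi0; rewrite integral_mkcond [RHS]integral_mkcond.
rewrite -[RHS](@integral_lebesgue_affine _ 1 b _ (oner_neq0 _)).
- rewrite normr1 mul1e; apply: eq_integral => x _; rewrite mul1r.
  by rewrite !patchE (_ : (x \in _) = (x + b \in A))//; apply/idP/idP; rewrite !inE.
- by apply/(measurable_restrictT _ _).1 => //; exact: measurable_funTS.
- by move=> x; apply: erestrict_ge0 => y _.
Qed.

Local Notation G := (cumul gauss).
Local Notation F := (cumul slab_weight).

Let mgauss : measurable_fun setT (EFin \o gauss).
Proof. by apply/measurable_EFinP; exact: (continuous_measurable_fun continuous_gauss). Qed.

Lemma slab_weight_le t : t <= -1 -> slab_weight t = gauss (t + 1).
Proof.
move=> t1; rewrite /slab_weight /gauss /slab_dist ler0_norm; last by lra.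
rewrite max_l; last by lra.
by rewrite -[- t - 1]opprD sqrrN.
Qed.

Lemma slab_weight_ge t : 1 <= t -> slab_weight t = gauss (t - 1).
Proof.
move=> t1; rewrite /slab_weight /gauss /slab_dist ger0_norm; last by lra.
by rewrite max_l //; lra.
Qed.

Lemma slab_weight_mid t : -1 <= t <= 1 -> slab_weight t = 1.
Proof.
move=> t1; rewrite /slab_weight /slab_dist max_r ?expr0n/= ?mulr0 ?oppr0 ?expR0//.
by rewrite subr_le0 ler_norml.
Qed.

Let cumulG s : ((G s)%:E = \int[mu]_(x in `]-oo, s]) (gauss x)%:E)%E.
Proof. exact: (cumulE continuous_gauss gauss_gt0 integral_gauss). Qed.

Let cumulGC s : (1%:E - (G s)%:E = \int[mu]_(x in `]s, +oo[) (gauss x)%:E)%E.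
Proof. exact: (cumulC continuous_gauss gauss_gt0 integral_gauss). Qed.

Let left_tail t : t <= -1 ->
  (\int[mu]_(x in `]-oo, t]) (slab_weight x)%:E = (G (t + 1))%:E)%E.
Proof.
move=> t1; rewrite cumulG -(@integral_shift 1 _ (EFin \o gauss))//=; last first.
  by move=> x; rewrite lee_fin ltW// gauss_gt0.
rewrite (_ : _ @^-1` _ = `]-oo, t]%classic); last first.
  by apply/seteqP; split => x /=; rewrite !in_itv/= lerD2r.
apply: eq_integral => x; rewrite inE/= in_itv/= => xt.
by rewrite slab_weight_le// (le_trans xt).
Qed.

Let right_tail t : 1 <= t ->
  (\int[mu]_(x in `]t, +oo[) (slab_weight x)%:E = (1 - G (t - 1))%:E)%E.
Proof.
move=> t1; rewrite EFinB cumulGC -(@integral_shift (-1) _ (EFin \o gauss))//=; last first.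
  by move=> x; rewrite lee_fin ltW// gauss_gt0.
rewrite (_ : _ @^-1` _ = `]t, +oo[%classic); last first.
  by apply/seteqP; split => x /=; rewrite !in_itv/= !andbT ltrD2r.
apply: eq_integral => x; rewrite inE/= in_itv/= andbT => xt.
by rewrite slab_weight_ge// (le_trans t1)// ltW.
Qed.

(** The interval $[-1,1]$ contributes twice the value at 0, and the two outer half-lines are
    translated to those issuing from 0. The mass 3 and the volume recursion for parallel bodies of
    the cube are both instances. *)
Lemma integral_slab_dist (psi : R -> \bar R) : measurable_fun setT psi ->
  (forall s, 0 <= psi s)%E -> (forall s, psi (- s) = psi s) ->
  (\int[mu]_t psi (slab_dist t) = 2%:E * psi 0%R + \int[mu]_s psi s)%E.
Proof.
move=> mpsi psi0 psiN.
have split3 (a b : R) (f : R -> \bar R) : a <= b -> measurable_fun setT f -> (forall s, 0 <= f s)%E ->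
    (\int[mu]_t f t = \int[mu]_(t in `]-oo, a]) f t
      + (\int[mu]_(t in `]a, b]) f t + \int[mu]_(t in `]b, +oo[) f t))%E.
  move=> ab mf f0.
  have -> : [set: R] = `]-oo, a]%classic `|` (`]a, b]%classic `|` `]b, +oo[%classic).
    apply/seteqP; split => // x _ /=; rewrite !in_itv/= andbT.
    have [|x1] := leP x a; [by left|right].
    by have [|x1'] := leP x b; [left|right].
  rewrite ge0_integral_setU//; last 3 first.
  - exact: measurableU.
  - exact: measurable_funTS.
  - rewrite disj_set2E; apply/eqP; rewrite -subset0 => x [] /=; rewrite !in_itv/= andbT.
    by move=> h1 [/andP[h2 _]|h2]; lra.
  rewrite ge0_integral_setU//; last 2 first.
  - exact: measurable_funTS.
  - rewrite disj_set2E; apply/eqP; rewrite -subset0 => x [] /=; rewrite !in_itv/= andbT.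
    by move=> /andP[_ h1] h2; lra.
have mpsid : measurable_fun setT (fun t => psi (slab_dist t)).
  exact: (measurableT_comp mpsi (continuous_measurable_fun continuous_slab_dist)).
have N11 : -1 <= 1 :> R by lra.
rewrite (split3 _ _ _ N11 mpsid (fun=> psi0 _)).
rewrite [X in _ = (_ + X)%E](split3 _ _ _ (lexx (0 : R)) mpsi psi0) set_itvoc0 integral_set0 add0e.
have -> : (\int[mu]_(t in `]-oo, (-1)%R]) psi (slab_dist t) = \int[mu]_(s in `]-oo, 0%R]) psi s)%E.
  rewrite -[RHS](@integral_shift 1)//.
  rewrite (_ : _ @^-1` _ = `]-oo, -1]%classic); last first.
    by apply/seteqP; split => x /=; rewrite !in_itv/= => h; lra.
  apply: eq_integral => x; rewrite inE/= in_itv/= => x1; rewrite -psiN; congr psi.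
  by rewrite /slab_dist ler0_norm ?max_l; lra.
have -> : (\int[mu]_(t in `]1%R, +oo[) psi (slab_dist t) = \int[mu]_(s in `]0%R, +oo[) psi s)%E.
  rewrite -[RHS](@integral_shift (-1))//.
  rewrite (_ : _ @^-1` _ = `]1, +oo[%classic); last first.
    by apply/seteqP; split => x /=; rewrite !in_itv/= !andbT => h; lra.
  apply: eq_integral => x; rewrite inE/= in_itv/= andbT => x1; congr psi.
  by rewrite /slab_dist ger0_norm ?max_l; lra.
have -> : (\int[mu]_(t in `](-1)%R, 1%R]) psi (slab_dist t) = 2%:E * psi 0%R)%E.
  rewrite (eq_integral (cst (psi 0))); last first.
    move=> x; rewrite inE/= in_itv/= => /andP[h1 h2] /=; congr psi.
    by rewrite /slab_dist max_r// subr_le0 ler_norml h2 ltW.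
  rewrite integral_cst//= lebesgue_measure_itv/= lte_fin.
  have -> : (-1 < 1 :> R) by lra.
  by rewrite -EFinB opprK muleC.
by rewrite addeCA.
Qed.

Lemma integral_slab_weight : (\int[mu]_x (slab_weight x)%:E = 3%:E)%E.
Proof.
have := @integral_slab_dist (EFin \o gauss) mgauss _ _.
rewrite /= integral_gauss => -> //.
- by rewrite /gauss expr0n/= mulr0 oppr0 expR0 mule1 -EFinD; congr EFin; lra.
- by move=> s; rewrite lee_fin ltW// gauss_gt0.
- by move=> s; rewrite /gauss sqrrN.
Qed.

Let Gd := cumul_is_derive continuous_gauss gauss_gt0 integral_gauss.
Let Fd := cumul_is_derive continuous_slab_weight slab_weight_gt0 integral_slab_weight.
Let Glt := cumul_lt continuous_gauss gauss_gt0 integral_gauss.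

Let Gle s t : G s <= G t -> s <= t.
Proof. by apply: contraLR; rewrite -!ltNge => /Glt. Qed.

(** The premise sits under the quantifier so that choice gives a total function, meaningful on
    $]0,1[$. *)
Let Ginv_ex y : exists s, 0 < y < 1 -> G s = y.
Proof.
have [y01|y01] := boolP (0 < y < 1); last by exists 0.
by have [s <-] := cumul_inv continuous_gauss gauss_gt0 integral_gauss y01; exists s.
Qed.

(** The map is $T=G^{-1}\circ(F/3)$, for the cumulative functions $G$ of the Gaussian and $F$ of
    [slab_weight]. The lower bound on $T'$ serves to make [Theta] expanding. *)
Lemma transport_map : exists T T' : R -> R,
  [/\ forall t : R, is_derive t 1 T (T' t), forall t, 3^-1 <= T' t &
      forall t, 3 * (T' t * gauss (T t)) = slab_weight t].
Proof.
pose Ginv y := projT1 (cid (Ginv_ex y)).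
have GinvK y : 0 < y < 1 -> G (Ginv y) = y by exact: (projT2 (cid (Ginv_ex y))).
have G01 s : 0 < G s < 1.
  rewrite (cumul_gt0 continuous_gauss gauss_gt0 integral_gauss)/=.
  exact: (cumul_ltc continuous_gauss gauss_gt0 integral_gauss).
have GK s : Ginv (G s) = s.
  have e := GinvK (G s) (G01 s).
  by apply/eqP; rewrite eq_le; apply/andP; split; apply: Gle; rewrite e.
pose T t := Ginv (F t / 3).
have FE t : 3 * G (T t) = F t.
  rewrite /T GinvK; first by field.
  have h1 := cumul_gt0 continuous_slab_weight slab_weight_gt0 integral_slab_weight t.
  have h2 := cumul_ltc continuous_slab_weight slab_weight_gt0 integral_slab_weight t.
  by apply/andP; split; lra.
pose T' t := (gauss (T t))^-1 * (slab_weight t / 3).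
exists T, T'; split.
- move=> t; rewrite /T'.
  have dF : is_derive t 1 (fun t : R => F t / 3) (slab_weight t / 3).
    rewrite (_ : (fun t : R => F t / 3) = (3^-1 : R) \*: F).
      by rewrite mulrC; apply: is_deriveZ; exact: Fd.
    by apply/funext => x /=; rewrite mulrC.
  apply: (@is_derive1_comp _ Ginv) => //.
  have -> : F t / 3 = G (T t) by rewrite -FE; field.
  apply: is_derive_inverse; [by near=> x; exact: GK| |exact: Gd|by rewrite gt_eqF// gauss_gt0].
  near=> x; apply: differentiable_continuous; rewrite -derivable1_diffP.
  by have [] := Gd x.
- move=> t; rewrite /T' mulrC ler_pdivlMr ?gauss_gt0// mulrC ler_pM2r ?invr_gt0//.
  (* It remains that [gauss (T t) <= slab_weight t]. For $t\le -1$, $F(t)=G(t+1)$ forces $T(t)\le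
     t+1\le 0$; for $t\ge 1$, $F(t)=2+G(t-1)$ forces $T(t)\ge t-1\ge 0$; in between [slab_weight] is
     1. *)
  have [t1|t1] := leP t (-1).
    rewrite slab_weight_le//; have : T t <= t + 1.
      apply: Gle; have : F t = G (t + 1).
        by apply: EFin_inj; rewrite -left_tail// (cumulE continuous_slab_weight slab_weight_gt0 integral_slab_weight).
      by rewrite -FE; have /andP[] := G01 (T t); lra.
    move=> h; rewrite /gauss ler_expR lerN2 ler_pM2l ?pi_gt0//.
    by nra.
  have [t2|t2] := leP 1 t; last first.
    rewrite slab_weight_mid; last by rewrite !ltW.
    by rewrite /gauss -[leRHS]expR0 ler_expR oppr_le0 mulr_ge0 ?pi_ge0 ?sqr_ge0.
  rewrite slab_weight_ge//; have : t - 1 <= T t.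
    apply: Gle; have : F t = 2 + G (t - 1).
      have := right_tail t2; rewrite -(cumulC continuous_slab_weight slab_weight_gt0 integral_slab_weight).
      by rewrite -EFinB => -[]; lra.
    by rewrite -FE; have /andP[] := G01 (t - 1); lra.
  move=> h; rewrite /gauss ler_expR lerN2 ler_pM2l ?pi_gt0//.
  by nra.
- move=> t; rewrite /T'; field; by rewrite gt_eqF// gauss_gt0.
Unshelve. all: by end_near. Qed.

End one_dimensional.

(** * The Brascamp-Lieb inequality for slabs *)

Lemma integral_gaussn (R : realType) n :
  (\int[leb R n]_x (expR (- (pi * edot x x)))%:E = 1)%E.
Proof.
elim: n => [|n IH].
  by rewrite leb0_integral//= edotE big_ord0 mulr0 oppr0 expR0.
have mg : measurable_fun setT (fun x : 'rV[R]_n.+1 => (expR (- (pi * edot x x)))%:E).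
  apply/measurable_EFinP; apply: measurableT_comp => //; apply: measurableT_comp => //.
  apply: measurable_funM => //.
  by have := @measurable_edot R n.+1 1%:M; under eq_fun do rewrite mulmx1.
rewrite lebS_integral//.
rewrite -[RHS](integral_gauss R); apply: eq_integral => t _.
have e (y : 'rV[R]_n) : expR (- (pi * edot (rcons0 (t, y)) (rcons0 (t, y)))) =
    gauss t * expR (- (pi * edot y y)).
  rewrite /gauss -expRD; congr expR; rewrite [X in pi * X]edotE big_ord_recl rcons0_0/=.
  rewrite edotE mulrDr opprD expr2; congr (_ - pi * _).
  by apply: eq_bigr => i _; rewrite rcons0_S.
under eq_integral => y _ do rewrite e EFinM.
rewrite ge0_integralZl//; first by rewrite IH mule1.
- apply/measurable_EFinP; apply: measurableT_comp => //; apply: measurableT_comp => //.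
  apply: measurable_funM => //.
  by have := @measurable_edot R n 1%:M; under eq_fun do rewrite mulmx1.
- by rewrite lee_fin ltW// gauss_gt0.
Qed.

Section brascamp_lieb.
Context (R : realType) (n : nat) (I : finType) (c : I -> R) (u : I -> 'rV[R]_n).
Hypothesis c0 : forall i, 0 <= c i.
Hypothesis u1 : forall i, edot (u i) (u i) = 1.
Hypothesis cu : \sum_i c i *: ((u i)^T *m u i) = 1%:M.

Lemma decomposition_dot x y : \sum_i c i * (edot x (u i) * edot y (u i)) = edot x y.
Proof.
rewrite -[RHS]/((x *m y^T) 0 0) -[x in RHS]mulmx1 -cu mulmx_sumr mulmx_suml summxE.
apply: eq_bigr => i _; rewrite -scalemxAr -scalemxAl mxE; congr (_ * _).
have -> : x *m ((u i)^T *m u i) *m y^T = (x *m (u i)^T) *m (u i *m y^T) by rewrite !mulmxA.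
by rewrite mulmx_sum_row big_ord1 !mxE (edotC y) /edot !mxE.
Qed.

Lemma sum_weights : \sum_i c i = n%:R.
Proof.
have := congr1 mxtrace cu; rewrite mxtrace1 raddf_sum/= => <-.
by apply: eq_bigr => i _; rewrite mxtraceZ edot_trace u1 mulr1.
Qed.

Variables T T' : R -> R.
Hypothesis dT : forall t : R, is_derive t 1 T (T' t).
Hypothesis T'3 : forall t, 3^-1 <= T' t.
Hypothesis Tgauss : forall t, 3 * (T' t * gauss (T t)) = slab_weight t.

Let Theta (x : 'rV[R]_n) := \sum_i (c i * T (edot x (u i))) *: u i.
Let D (x : 'rV[R]_n) := \sum_i (c i * T' (edot x (u i))) *: ((u i)^T *m u i).

Let cT : continuous T.
Proof.
by move=> t; apply: differentiable_continuous; rewrite -derivable1_diffP; have [] := dT t.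
Qed.

Let T_mono a b : (a - b) ^+ 2 <= 3 * ((T a - T b) * (a - b)).
Proof.
wlog ab : a b / b < a.
  move=> wl; have [ab|ab|->] := ltgtP a b; last by rewrite !subrr mulr0 mulr0 expr0n.
    by have := wl _ _ ab; rewrite -(opprB a b) -(opprB (T a)) mulrNN sqrrN.
  exact: wl.
have [|s _ ->] := @MVT R T T' b a ab.
  by apply: derivable_within_continuous => x _; have [] := dT x.
have := T'3 s; have := sqr_ge0 (a - b); rewrite -mulrA -expr2 mulrA.
by move=> h1 h2; rewrite ler_peMl//; lra.
Qed.

Let T_diff t e : 0 < e ->
  \forall s \near t, `|T s - T t - T' t * (s - t)| <= e * `|s - t|.
Proof.
move=> e0; have [dt T'E] := dT t.
have cv : h^-1 *: (T (h + t) - T t) @[h --> 0^'] --> T' t.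
  rewrite -T'E; move: dt => /cvg_ex[l hl].
  rewrite /derive (cvg_lim _ hl)//.
  by move: hl; under [in X in X -> _]eq_fun do rewrite scaler1.
move/cvgrPdist_le : cv => /(_ e e0) /nbhs_ballP[d /= d0 hd].
apply/nbhs_ballP; exists d => // s /=; rewrite -ball_normE/= => st.
have [->|st0] := eqVneq s t; first by rewrite !subrr mulr0 subrr normr0 mulr0.
have st1 : s - t != 0 by rewrite subr_eq0.
have := hd (s - t); rewrite -ball_normE/= sub0r normrN distrC => /(_ st st1).
rewrite subrK => h.
have -> : T s - T t - T' t * (s - t) = - (T' t - (s - t)^-1 *: (T s - T t)) * (s - t).
  by rewrite /GRing.scale/=; field.
by rewrite normrM normrN (distrC s t); apply: ler_wpM2r.
Qed.

Let edot_norm (x y : 'rV[R]_n) : `|edot x y| <= n%:R * (`|x| * `|y|).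
Proof.
rewrite edotE (le_trans (ler_norm_sum _ _ _))//.
apply: (@le_trans _ _ (\sum_(i < n) `|x| * `|y|)).
  by apply: ler_sum => i _; rewrite normrM ler_pM// rv_norm_coor.
by rewrite sumr_const card_ord mulr_natl.
Qed.

Let norm_edot (x : 'rV[R]_n) : `|x| ^+ 2 <= edot x x.
Proof.
rewrite -enorm_sqr ler_sqr ?nnegrE ?enorm_ge0//; apply: rv_norm_le; first exact: enorm_ge0.
move=> i; rewrite -ler_sqr ?nnegrE ?enorm_ge0// enorm_sqr real_normK ?num_real//.
rewrite edotE (bigD1 i)//= -expr2 lerDl; apply: sumr_ge0 => j _.
by rewrite -expr2 sqr_ge0.
Qed.

Let norm_u i : `|u i| <= 1.
Proof.
by rewrite -ler_sqr ?nnegrE// expr1n -(u1 i); exact: norm_edot.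
Qed.

Let edot_suml (J : finType) (f : J -> 'rV[R]_n) y : edot (\sum_j f j) y = \sum_j edot (f j) y.
Proof. by rewrite /edot mulmx_suml summxE. Qed.

(** By [T_mono] and the decomposition of the identity, $|z|_2^2\le 3\langle\Theta x-\Theta
    y,z\rangle$ for $z=x-y$. The factor [n] comes from bounding the scalar product by sup norms; the
    added 1 keeps the constant positive in dimension 0. *)
Let Theta_expand x y : `|x - y| <= (3 * n%:R + 1) * `|Theta x - Theta y|.
Proof.
set z := x - y; set v := _ - _.
have h1 : edot z z <= 3 * edot v z.
  have -> : edot v z = \sum_i c i * ((T (edot x (u i)) - T (edot y (u i))) *
      (edot x (u i) - edot y (u i))).
    rewrite /v /Theta -sumrB edot_suml; apply: eq_bigr => i _.
    rewrite -scalerBl edotZl (edotC (u i)) /z edotDl edotNl; ring.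
  rewrite -decomposition_dot mulr_sumr; apply: ler_sum => i _.
  rewrite [leRHS]mulrCA ler_wpM2l// -expr2 /z edotDl edotNl; exact: T_mono.
have h2 : `|z| * `|z| <= (3 * n%:R * `|v|) * `|z|.
  rewrite -expr2 (le_trans (norm_edot z))// (le_trans h1)// -!mulrA ler_pM2l//.
  by rewrite (le_trans (ler_norm _))// edot_norm.
have [z0|z0] := eqVneq `|z| 0; first by rewrite z0 mulr_ge0// addr_ge0// mulr_ge0.
rewrite (@le_trans _ _ (3 * n%:R * `|v|))//; last by rewrite ler_wpM2r// lerDl.
by move: h2; rewrite ler_pM2r// lt_neqAle eq_sym z0 normr_ge0.
Qed.

Let Theta_diff x e : 0 < e -> exists2 d, 0 < d & forall y, `|y - x| <= d ->
  `|Theta y - Theta x - (y - x) *m D x| <= e * `|y - x|.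
Proof.
(* One factor [n] is the sum of the weights, the other comes from [edot_norm]. *)
move=> e0; pose e' := e / (n%:R * n%:R + 1).
have e'0 : 0 < e' by rewrite divr_gt0// ltr_wpDl// mulr_ge0.
have cd i : continuous (fun y : 'rV[R]_n => edot y (u i)).
  by apply: (@continuous_edot _ _ _ id (fun=> u i)); [move=> y; exact: cvg_id|exact: cst_continuous].
pose P i (y : 'rV[R]_n) :=
    `|T (edot y (u i)) - T (edot x (u i)) - T' (edot x (u i)) * (edot y (u i) - edot x (u i))|
      <= e' * `|edot y (u i) - edot x (u i)|.
have nP i : \forall y \near x, P i y by exact: (cd i x _ (T_diff (edot x (u i)) e'0)).
have /nbhs_rvP[d d0 hd] : \forall y \near x, forall i, P i y.
  exact: (@filter_forall _ _ P (nbhs x) (nbhs_filter x) nP).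
exists d => // y yx; have {}hd := hd y yx.
have -> : Theta y - Theta x - (y - x) *m D x = \sum_i (c i * (T (edot y (u i)) - T (edot x (u i))
     - T' (edot x (u i)) * (edot y (u i) - edot x (u i)))) *: u i.
  rewrite /Theta /D mulmx_sumr -!sumrB; apply: eq_bigr => i _.
  rewrite -scalemxAr mulmxA [(y - x) *m (u i)^T]mx11_scalar -/(edot _ _) mul_scalar_mx scalerA.
  by rewrite -!scalerBl edotDl edotNl; congr (_ *: _); ring.
apply: (le_trans (ler_norm_sum _ _ _)).
apply: (@le_trans _ _ (\sum_i c i * (e' * (n%:R * `|y - x|)))).
  apply: ler_sum => i _; rewrite normrZ normrM (ger0_norm (c0 i)) -mulrA ler_wpM2l//.
  rewrite -[leRHS]mulr1 ler_pM//; apply: (le_trans (hd i)).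
  rewrite ler_pM2l// -edotNl -edotDl (le_trans (edot_norm _ _))// ler_wpM2l//.
  by rewrite -[leRHS]mulr1 ler_wpM2l.
rewrite -mulr_suml sum_weights /e'.
have -> : n%:R * (e / (n%:R * n%:R + 1) * (n%:R * `|y - x|)) =
   e * `|y - x| * (n%:R * n%:R / (n%:R * n%:R + 1)).
  by field; rewrite gt_eqF// ltr_wpDl// mulr_ge0.
rewrite -[leRHS]mulr1 ler_wpM2l ?mulr_ge0 ?(ltW e0)// ler_pdivrMr ?mul1r ?lerDl//.
Qed.

Let T'_gt0 t : 0 < T' t.
Proof. by apply: lt_le_trans (T'3 t); rewrite invr_gt0. Qed.

Let q (x : 'rV[R]_n) := \sum_i c i * slab_dist (edot x (u i)) ^+ 2.

(** With $y=\sum c_iT_iu_i$, expanding $0\le\sum c_i(T_i-\langle y,u_i\rangle)^2$ gives $\sum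
    c_iT_i^2-|y|^2$. *)
Let Theta_norm x : edot (Theta x) (Theta x) <= \sum_i c i * T (edot x (u i)) ^+ 2.
Proof.
set y := Theta x.
have h1 : edot y y = \sum_i c i * (T (edot x (u i)) * edot y (u i)).
  rewrite {1}/y /Theta edot_suml; apply: eq_bigr => i _.
  by rewrite edotZl (edotC (u i)) mulrA.
have h2 := decomposition_dot y y.
have : 0 <= \sum_i c i * (T (edot x (u i)) - edot y (u i)) ^+ 2.
  by apply: sumr_ge0 => i _; rewrite mulr_ge0// sqr_ge0.
have -> : \sum_i c i * (T (edot x (u i)) - edot y (u i)) ^+ 2 =
    \sum_i c i * T (edot x (u i)) ^+ 2
    - 2 * (\sum_i c i * (T (edot x (u i)) * edot y (u i)))
    + \sum_i c i * (edot y (u i) * edot y (u i)).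
  by rewrite mulr_sumr -sumrB -big_split/=; apply: eq_bigr => i _; ring.
by rewrite -h1 h2; lra.
Qed.

(** Taking logarithms in [Tgauss] expresses $\ln T'$ as $\pi T^2-\pi d^2-\ln 3$. Averaged with the
    weights, which sum to [n], it bounds [\det (D x)] from below by [det_sum_ge], and [Theta_norm]
    replaces $\sum c_iT_i^2$ by $|\Theta x|^2$. *)
Let density_le x : expR (- (pi * q x)) <=
  \det (D x) * (3 ^+ n * expR (- (pi * edot (Theta x) (Theta x)))).
Proof.
pose s i := ln (T' (edot x (u i))).
have DE : D x = \sum_i (c i * expR (s i)) *: ((u i)^T *m u i).
  by apply: eq_bigr => i _; rewrite /s lnK// posrE.
have detD : expR (\sum_i c i * s i) <= \det (D x).
  by rewrite DE; apply: det_sum_ge => // i; rewrite edot_trace.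
have sE i : s i = pi * T (edot x (u i)) ^+ 2 - pi * slab_dist (edot x (u i)) ^+ 2 - ln 3.
  have := Tgauss (edot x (u i)); rewrite /slab_weight /gauss => /(congr1 (@ln R)).
  rewrite lnM ?posrE ?mulr_gt0 ?expR_gt0// lnM ?posrE ?expR_gt0// !expRK /s.
  lra.
apply: (@le_trans _ _ (expR (\sum_i c i * s i) *
    (3 ^+ n * expR (- (pi * edot (Theta x) (Theta x)))))); last first.
  by rewrite ler_wpM2r// mulr_ge0 ?expR_ge0// exprn_ge0.
have -> : 3 ^+ n = expR (n%:R * ln 3) :> R.
  by rewrite mulrC expRM_natr lnK// posrE.
rewrite -!expRD ler_expR.
have -> : \sum_i c i * s i = pi * (\sum_i c i * T (edot x (u i)) ^+ 2) - pi * q x - ln 3 * \sum_i c i.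
  rewrite /q !mulr_sumr -!sumrB; apply: eq_bigr => i _; rewrite sE; ring.
rewrite sum_weights; have := Theta_norm x; rewrite -(ler_pM2l (pi_gt0 R)).
by lra.
Qed.

Let contq : continuous q.
Proof.
apply: continuous_bigsum => i; apply: continuousMR; first exact: cst_continuous.
have cs : continuous (fun x : 'rV[R]_n => slab_dist (edot x (u i))).
  move=> x; apply: (@continuous_comp _ _ _ (fun x : 'rV[R]_n => edot x (u i)) (@slab_dist R)).
    by apply: (@continuous_edot _ _ _ id (fun=> u i)); [move=> y; exact: cvg_id|exact: cst_continuous].
  exact: continuous_slab_dist.
by under eq_fun do rewrite expr2; exact: continuousMR.
Qed.

Lemma measurable_edotl v : measurable_fun setT (fun x : 'rV[R]_n => edot x v).
Proof.
under eq_fun do rewrite edotE; apply: measurable_sum => i; apply: measurable_funM => //.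
exact: measurable_coor.
Qed.

Lemma measurable_slab_sum :
  measurable_fun setT (fun x : 'rV[R]_n => \sum_i c i * slab_dist (edot x (u i)) ^+ 2).
Proof.
apply: measurable_sum => i; apply: measurable_funM => //.
under eq_fun do rewrite expr2; apply: measurable_funM;
apply: (measurableT_comp (continuous_measurable_fun (@continuous_slab_dist R)));
exact: measurable_edotl.
Qed.

Let continuous_expN (f : 'rV[R]_n -> R) : continuous f -> continuous (fun x => expR (- (pi * f x))).
Proof.
move=> cf.
have cpf : continuous (fun x => - (pi * f x)).
  rewrite (_ : (fun x => _) = (fun x => 0 - pi * f x)); last first.
    by apply/funext => x; rewrite sub0r.
  apply: continuousBR; first exact: cst_continuous.
  by apply: continuousMR => //; exact: cst_continuous.
move=> x; apply: (@continuous_comp _ _ _ (fun x => - (pi * f x)) expR); first exact: cpf.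
exact: continuous_expR.
Qed.

Let measurable_expN f : measurable_fun setT (f : 'rV[R]_n -> R) ->
  measurable_fun setT (fun x => expR (- (pi * f x))).
Proof.
move=> mf; apply: (measurableT_comp (@measurable_expR R)).
by apply: measurableT_comp => //; exact: measurable_funM.
Qed.

Lemma brascamp_lieb_slabs_aux : (\int[leb R n]_x (expR (- (pi * q x)))%:E <= (3 ^+ n)%:E)%E.
Proof.
have measq : measurable_fun setT q by exact: measurable_slab_sum.
have ce : continuous (fun y : 'rV[R]_n => edot y y).
  by apply: continuous_edot => y; exact: cvg_id.
have me : measurable_fun setT (fun y : 'rV[R]_n => edot y y).
  by have := @measurable_edot R n 1%:M; under eq_fun do rewrite mulmx1.
have -> : ((3 ^+ n)%:E = \int[leb R n]_y (3 ^+ n * expR (- (pi * edot y y)))%:E)%E.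
  under eq_integral => y _ do rewrite EFinM.
  rewrite ge0_integralZl//; first by rewrite integral_gaussn mule1.
  by apply/measurable_EFinP; exact: measurable_expN.
(* The left side of [density_le] is positive, and so is the factor multiplying the determinant. *)
have detD x : 0 < \det (D x).
  have := density_le x; have := expR_gt0 (- (pi * q x)).
  move=> h1 /(lt_le_trans h1); rewrite pmulr_lgt0// mulr_gt0 ?expR_gt0// exprn_gt0//.
apply: (@transport_le _ _ Theta D (3 * n%:R + 1)).
- by rewrite ltr_wpDl// mulr_ge0.
- exact: Theta_expand.
- exact: Theta_diff.
- by move=> x; rewrite unitmxE unitfE gt_eqF.
- apply: continuous_rv => j; under eq_fun do rewrite summxE.
  apply: continuous_bigsum => i; under eq_fun do rewrite mxE.
  apply: continuousMR; last exact: cst_continuous.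
  apply: continuousMR; first exact: cst_continuous.
  move=> x; apply: (@continuous_comp _ _ _ (fun x : 'rV[R]_n => edot x (u i)) T); last exact: cT.
  by apply: (@continuous_edot _ _ _ id (fun=> u i)); [move=> y; exact: cvg_id|exact: cst_continuous].
- apply: measurable_fun_rv => j; under eq_fun do rewrite summxE.
  apply: measurable_sum => i; under eq_fun do rewrite mxE.
  apply: measurable_funM => //; apply: measurable_funM => //.
  apply: (measurableT_comp (continuous_measurable_fun cT)); exact: measurable_edotl.
- exact: continuous_expN.
- by apply: continuousMR; [exact: cst_continuous|exact: continuous_expN].
- exact: measurable_expN.
- by apply: measurable_funM => //; exact: measurable_expN.
- by move=> x; exact: expR_ge0.
- by move=> x; rewrite mulr_gt0 ?expR_gt0// exprn_gt0.
- by move=> x; rewrite gtr0_norm//; exact: density_le.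
Qed.

End brascamp_lieb.

Lemma brascamp_lieb_slabs (R : realType) n (I : finType) (c : I -> R) (u : I -> 'rV[R]_n) :
  (forall i, 0 <= c i) -> (forall i, edot (u i) (u i) = 1) ->
  \sum_i c i *: ((u i)^T *m u i) = 1%:M ->
  (\int[leb R n]_x (expR (- (pi * \sum_i c i * slab_dist (edot x (u i)) ^+ 2)))%:E
    <= (3 ^+ n)%:E)%E.
Proof.
move=> c0 u1 cu; have [T [T' [dT T'3 TT']]] := @transport_map R.
exact: (brascamp_lieb_slabs_aux c0 u1 cu dT T'3 TT').
Qed.

(** * The Steiner formula and the Wills functional *)

Section layer_cake.
Context (R : realType).
Local Notation mu := (@lebesgue_measure R).

Definition radial_weight (l : R) : R := 2 * pi * l * gauss l.

Lemma is_derive_gauss (l : R) : is_derive l 1 (@gauss R) (- radial_weight l).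
Proof.
rewrite (_ : @gauss R = expR \o (fun t => - (pi * t ^+ 2)))//.
have d2 : is_derive l 1 (fun t : R => t ^+ 2) (2 * l).
  by apply: is_derive_eq; rewrite /GRing.scale/=; ring.
have d1 : is_derive l 1 (fun t : R => - (pi * t ^+ 2)) (- (pi * (2 * l))).
  by apply: is_deriveN; apply: is_deriveZ.
have -> : - radial_weight l = expR (- (pi * l ^+ 2)) * - (pi * (2 * l)).
  by rewrite /radial_weight /gauss; ring.
exact: is_derive1_comp.
Qed.

Lemma continuous_radial_weight : continuous radial_weight.
Proof.
rewrite (_ : radial_weight = fun l => 2 * pi * l * gauss l)//.
apply: continuousMR; last exact: continuous_gauss.
by apply: continuousMR; [exact: cst_continuous|move=> x; exact: cvg_id].
Qed.

Lemma radial_weight_ge0 l : 0 <= l -> 0 <= radial_weight l.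
Proof. by move=> l0; rewrite !mulr_ge0 ?pi_ge0 ?expR_ge0. Qed.

Lemma cvg_gauss : gauss x @[x --> +oo] --> (0 : R).
Proof.
apply: (@squeeze_cvgr _ _ _ _ (fun=> 0) (@gauss_fun R)); last exact: cvg_gauss_fun.
  near=> x; rewrite expR_ge0/= ler_expR lerN2 ler_peMl ?sqr_ge0//.
  by have := @pi_ge2 R; lra.
exact: cvg_cst.
Unshelve. all: by end_near. Qed.

Lemma integral_radial_weight (a : R) : 0 <= a ->
  (\int[mu]_(l in `[a, +oo[) (radial_weight l)%:E = (gauss a)%:E)%E.
Proof.
move=> a0; rewrite (@ge0_continuous_FTC2y _ _ (fun l => - gauss l) a 0).
- by rewrite EFinN sub0e oppeK.
- by move=> x ax; rewrite radial_weight_ge0// (le_trans a0).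
- by apply: continuous_subspaceT; exact: continuous_radial_weight.
- by rewrite -oppr0; apply: cvgN; exact: cvg_gauss.
- by move=> x _; apply: derivableN; have [] := is_derive_gauss x.
- by apply: cvg_at_right_filter; apply: cvgN; exact: continuous_gauss.
- move=> x _; rewrite derive1E; have [d e] := is_derive_gauss x.
  by rewrite deriveN// e opprK.
Qed.

Context (n : nat) (q : 'rV[R]_n -> R).
Hypothesis mq : measurable_fun setT q.

Let msub (r : R) : measurable [set x | q x <= r].
Proof.
rewrite (_ : mkset _ = q @^-1` `]-oo, r]%classic).
  by rewrite -[X in measurable X]setTI; exact: mq.
by apply/seteqP; split => x /=; rewrite in_itv.
Qed.

Lemma measurable_sublevel : measurable_fun setT (fun r : R => leb R n [set x | q x <= r]).
Proof.
pose A : set (measurableTypeR R * 'rV[R]_n) := [set p | q p.2 <= p.1].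
have mA : measurable A.
  have m1 : measurable_fun setT (fun p : measurableTypeR R * 'rV[R]_n => (p.1 : R)) by exact: measurable_fst.
  have m2 : measurable_fun setT (fun p : measurableTypeR R * 'rV[R]_n => q p.2).
    exact: (measurableT_comp mq measurable_snd).
  by have := measurable_fun_le measurableT m2 m1; rewrite setTI.
have := @measurable_fun_xsection _ _ _ _ R (leb R n) A mA.
congr (measurable_fun _ _); apply/funext => r /=; congr (leb R n _).
by apply/seteqP; split => x; rewrite /xsection/= inE.
Qed.

Hypothesis q0 : forall x, 0 <= q x.

(** Tonelli's theorem: for fixed [x] the admissible [l] form the half-line from [Num.sqrt (q x)],
    whose weight is [gauss (Num.sqrt (q x))]. *)
Lemma layer_cake :
  (\int[mu]_(l in `[0%R, +oo[) (leb R n [set x | q x <= l ^+ 2]%R * (radial_weight l)%:E) =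
   \int[leb R n]_x (expR (- (pi * q x)))%:E)%E.
Proof.
pose F (p : measurableTypeR R * 'rV[R]_n) : \bar R :=
  (((radial_weight p.1) * (\1_[set r | 0 <= r] p.1 * \1_[set r | 0 <= r] (p.1 ^+ 2 - q p.2)))%:E)%E.
have m1 : measurable_fun setT (fun p : measurableTypeR R * 'rV[R]_n => (p.1 : R)) by exact: measurable_fst.
have m2 : measurable_fun setT (fun p : measurableTypeR R * 'rV[R]_n => q p.2).
  exact: (measurableT_comp mq measurable_snd).
have mpos : measurable [set r : R | 0 <= r].
  rewrite (_ : mkset _ = `[0, +oo[%classic); first exact: measurable_itv.
  by apply/seteqP; split => x /=; rewrite in_itv/= andbT.
have m1pos : measurable_fun setT (\1_[set r : R | 0 <= r] : R -> R) by exact: measurable_indic.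
have mF : measurable_fun setT F.
  apply/measurable_EFinP; apply: measurable_funM.
    exact: (measurableT_comp (continuous_measurable_fun continuous_radial_weight) m1).
  apply: measurable_funM; first exact: (measurableT_comp m1pos m1).
  apply: (measurableT_comp m1pos); apply: measurable_funB => //.
  by under eq_fun do rewrite expr2; exact: measurable_funM.
have F0 p : (0 <= F p)%E.
  rewrite /F lee_fin [\1__ p.1]indicE; case: (boolP (p.1 \in _)).
    by rewrite inE/= => p0; rewrite mulr_ge0 ?radial_weight_ge0// mul1r.
  by rewrite mul0r mulr0.
transitivity (\int[mu]_l \int[leb R n]_x F (l, x))%E.
  rewrite integral_mkcond; apply: eq_integral => l _; rewrite patchE.
  case: ifPn => [|].
    rewrite inE/= in_itv/= andbT => l0.
    under [RHS]eq_integral => x _.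
      rewrite /F/= [\1__ l]indicE mem_set//= mul1r EFinM.
      rewrite (_ : \1__ (l ^+ 2 - q x) = \1_[set x | q x <= l ^+ 2] x); last first.
        rewrite !indicE; congr (_%:R); apply: congr1; apply/idP/idP; rewrite !inE/= subr_ge0//.
      over.
    rewrite ge0_integralZl//.
    - by rewrite integral_indic// setIT muleC.
    - by apply/measurable_EFinP; exact: measurable_indic.
    - by rewrite lee_fin radial_weight_ge0.
  move=> l0; rewrite integral0_eq// => x _; rewrite /F/= [\1__ l]indicE memNset.
    by rewrite mul0r mulr0.
  by move=> /= h; move/negP: l0; apply; rewrite inE/= in_itv/= h.
rewrite (@fubini_tonelli _ _ _ _ _ mu (leb R n) F)//.
apply: eq_integral => x _ /=.
have sq0 : 0 <= Num.sqrt (q x) by exact: sqrtr_ge0.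
transitivity (\int[mu]_(l in `[Num.sqrt (q x), +oo[) (radial_weight l)%:E)%E.
  rewrite [RHS]integral_mkcond; apply: eq_integral => l _; rewrite patchE /F/=.
  have I1 (z : R) : \1_[set r : R | 0 <= r] z = (0 <= z)%R%:R :> R.
    by rewrite indicE; congr (_%:R); apply: congr1; apply/idP/idP; rewrite inE.
  rewrite !I1 -natrM mulnb.
  have -> : (0 <= l) && (0 <= l ^+ 2 - q x) = (l \in `[Num.sqrt (q x), +oo[%classic).
    apply/idP/idP; rewrite inE/= in_itv/= andbT subr_ge0.
      by move=> /andP[l0 ql]; rewrite -(ger0_norm l0) -sqrtr_sqr ler_wsqrtr.
    move=> ql; have l0 := le_trans sq0 ql.
    by rewrite l0/= -(sqr_sqrtr (q0 x)) ler_sqr ?nnegrE.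
  by case: ifP => _; rewrite ?mulr1 ?mulr0.
by rewrite integral_radial_weight// /gauss sqr_sqrtr.
Qed.

End layer_cake.

(** * Parallel volumes of the cube *)

Section ball_sublevel.
Context (R : realType).
Local Notation mu := (@lebesgue_measure R).

Lemma measurable_edot_self n : measurable_fun setT (fun x : 'rV[R]_n => edot x x).
Proof. by have := @measurable_edot R n 1%:M; under eq_fun do rewrite mulmx1. Qed.

Lemma kappaE n : ((kappa R n)%:E = leb R n (unit_ball R n))%E.
Proof.
rewrite /kappa volE fineK// ge0_fin_numE// ?leb_unit_ball_lty//.
Qed.

Lemma kappa_gt0 n : 0 < kappa R n.
Proof. by rewrite -lte_fin kappaE leb_unit_ball_gt0. Qed.

(* [r] is the squared radius; the ball is empty for [r < 0]. *)
Definition ball_vol n (r : R) : \bar R := leb R n [set x | edot x x <= r].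
Local Arguments ball_vol n%_N r%_R.

Lemma ball_vol_ge0 n r : (0 <= ball_vol n r)%E.
Proof. exact: measure_ge0. Qed.

Lemma measurable_ball_vol n : measurable_fun setT (ball_vol n).
Proof. exact: (measurable_sublevel (@measurable_edot_self n)). Qed.

Let measurable_ball n r : measurable [set x : 'rV[R]_n | edot x x <= r].
Proof.
rewrite (_ : mkset _ = (fun x : 'rV[R]_n => edot x x) @^-1` `]-oo, r]%classic).
  by rewrite -[X in measurable X]setTI; apply: measurable_edot_self.
by apply/seteqP; split => x /=; rewrite in_itv.
Qed.

Let ball_vol_gt0 n l : 0 < l -> ball_vol n (l ^+ 2) = (kappa R n * l ^+ n)%:E.
Proof.
move=> l0; have l1 : l^-1 != 0 by rewrite invr_eq0 gt_eqF.
have uA : ((l^-1)%:M : 'M[R]_n) \in unitmx.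
  by rewrite unitmxE det_scalar unitfE expf_neq0.
have := @leb_preimage_affine R n (l^-1)%:M 0 _ uA (@measurable_unit_ball R n).
rewrite -kappaE det_scalar ger0_norm ?exprn_ge0 ?invr_ge0 ?ltW//.
have -> : (fun x : 'rV[R]_n => x *m (l^-1)%:M + 0) @^-1` unit_ball R n = [set x | edot x x <= l ^+ 2].
  apply/seteqP; split => x; rewrite /preimage/unit_ball/= enorm_le1 addr0 mul_mx_scalar edotZl edotZr;
  by rewrite mulrA -expr2 exprVn mulrC ler_pdivrMr ?exprn_gt0// mul1r.
move=> /(congr1 (fun z => (l ^+ n)%:E * z)%E); rewrite muleA -!EFinM exprVn divff ?mul1e.
  by rewrite mulrC.
by rewrite expf_neq0// gt_eqF.
Qed.

(** Scaling covers [0 < l]. At [l = 0] the ball is a point: in dimension 0 it has the volume of any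
    ball, in accordance with $0^0=1$, and otherwise it is contained in arbitrarily small balls. *)
Lemma ball_volE n l : 0 <= l -> ball_vol n (l ^+ 2) = (kappa R n * l ^+ n)%:E.
Proof.
rewrite le_eqVlt => /predU1P[<-|]; last exact: ball_vol_gt0.
have sub s : (ball_vol n (0 ^+ 2)%R <= ball_vol n (s ^+ 2)%R)%E.
  apply: le_measure; rewrite ?inE//; [exact: measurable_ball|exact: measurable_ball|].
  by move=> x /= /le_trans; apply; rewrite expr0n/= sqr_ge0.
case: n sub => [|n] sub.
  have -> : kappa R 0 * 0 ^+ 0 = kappa R 0 * 1 ^+ 0 by rewrite !expr0.
  rewrite -ball_vol_gt0// /ball_vol; congr (leb R 0 _).
  by apply/seteqP; split => x /= _; rewrite edotE big_ord0 sqr_ge0.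
rewrite [in RHS]expr0n/= mulr0; apply/eqP; rewrite eq_le ball_vol_ge0 andbT.
apply/lee_addgt0Pr => e e0; rewrite add0e.
have k0 := kappa_gt0 n.+1.
pose s := Num.min 1 (e / kappa R n.+1).
have s0 : 0 < s by rewrite lt_min ltr01 divr_gt0.
apply: (le_trans (sub s)); rewrite ball_vol_gt0// lee_fin mulrC -ler_pdivlMr//.
apply: (@le_trans _ _ s); last by rewrite /s ge_min lexx orbT.
by rewrite exprS ler_piMr ?(ltW s0)// exprn_ile1 ?(ltW s0)// /s ge_min lexx.
Qed.

Lemma edot_rcons0 n (t : R) (y : 'rV[R]_n) :
  edot (rcons0 (t, y)) (rcons0 (t, y)) = t ^+ 2 + edot y y.
Proof.
rewrite [LHS]edotE big_ord_recl rcons0_0/= -expr2 edotE; congr (_ + _).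
by apply: eq_bigr => i _; rewrite rcons0_S.
Qed.

Lemma ball_volS n r : (ball_vol n.+1 r = \int[mu]_t ball_vol n (r - t ^+ 2))%E.
Proof.
rewrite /ball_vol lebSE; apply: eq_integral => t _; congr (leb R n _).
by apply/seteqP; split => y /=; rewrite edot_rcons0 lerBrDl.
Qed.

(** The squared distance to the cube, which adds up over the coordinates. *)
Definition cube_sqdist n (x : 'rV[R]_n) : R := \sum_(i < n) slab_dist (x ord0 i) ^+ 2.

(** Slice along one coordinate: by [integral_slab_dist], a [j]-dimensional ball term yields twice
    itself plus the term of dimension [j.+1], and Pascal's rule collects them. Negative [r] is
    included since slices far from the cube have empty sublevels. *)
Lemma cube_vol n (r : R) : leb R n [set x | cube_sqdist x <= r] =
  (\sum_(j < n.+1) ('C(n, j) * 2 ^ (n - j))%N%:R%:E * ball_vol j r)%E.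
Proof.
elim: n r => [|n IH] r.
  rewrite big_ord1 bin0 subn0 mul1n expn0 mul1e /ball_vol; congr (leb R 0 _).
  by apply/seteqP; split => x /=; rewrite /cube_sqdist big_ord0 edotE big_ord0.
rewrite lebSE.
transitivity (\int[mu]_t leb R n [set y | cube_sqdist y <= r - slab_dist t ^+ 2]%R)%E.
  apply: eq_integral => t _; congr (leb R n _).
  have E y : cube_sqdist (rcons0 (t, y)) = slab_dist t ^+ 2 + cube_sqdist y.
    rewrite /cube_sqdist big_ord_recl rcons0_0/=; congr (_ + _).
    by apply: eq_bigr => i _; rewrite rcons0_S.
  by apply/seteqP; split => y /=; rewrite E lerBrDl.
under eq_integral => t _ do rewrite IH.
have mB j : measurable_fun setT (fun s : R => ball_vol j (r - s ^+ 2)).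
  by apply: (measurableT_comp (measurable_ball_vol j)); apply: measurable_funB.
have mBs j : measurable_fun setT (fun t : R => ball_vol j (r - slab_dist t ^+ 2)).
  exact: (measurableT_comp (mB j) (continuous_measurable_fun (@continuous_slab_dist R))).
rewrite ge0_integral_sum//; last 2 first.
- by move=> j; apply: measurable_funeM; exact: mBs.
- by move=> j t _; rewrite mule_ge0// ?ball_vol_ge0// lee_fin.
have step j : (\int[mu]_t (('C(n, j) * 2 ^ (n - j))%N%:R%:E * ball_vol j (r - slab_dist t ^+ 2)) =
    ('C(n, j) * 2 ^ (n - j))%N%:R%:E * (2%:E * ball_vol j r + ball_vol j.+1 r))%E.
  rewrite ge0_integralZl//; last exact: mBs.
  rewrite (@integral_slab_dist R (fun s => ball_vol j (r - s ^+ 2)))//.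
  - by rewrite expr0n/= subr0 ball_volS.
  - by move=> s; rewrite sqrrN.
under eq_bigr => j _ do rewrite step ge0_muleDr ?mule_ge0 ?ball_vol_ge0 ?lee_fin//.
rewrite big_split/= [in RHS]big_ord_recl/=.
have -> : (\sum_(j < n.+1) ('C(n, j) * 2 ^ (n - j))%N%:R%:E * (2%:E * ball_vol j r) =
   \sum_(j < n.+2) ('C(n, j) * 2 ^ (n.+1 - j))%N%:R%:E * ball_vol j r)%E.
  rewrite [RHS]big_ord_recr/= bin_small// mul0n mul0e adde0.
  apply: eq_bigr => j _; rewrite muleA -EFinM -natrM -mulnA -expnSr subSn//.
  by rewrite -ltnS ltn_ord.
rewrite [in LHS]big_ord_recl/= !bin0 -addeA; congr (_ + _)%E.
rewrite -big_split/=; apply: eq_bigr => j _.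
rewrite /bump/= !add1n subSS binS mulnDl natrD EFinD ge0_muleDl ?lee_fin//.
Qed.

Lemma parallel_cubeE n l : 0 <= l ->
  parallel_body (cube R n) l = [set x | cube_sqdist x <= l ^+ 2].
Proof.
move=> l0; apply/seteqP; split => x.
  move=> [k kC [y yB <-]] /=; rewrite /cube_sqdist.
  apply: (@le_trans _ _ (\sum_(i < n) l ^+ 2 * (y ord0 i * y ord0 i))); last first.
    rewrite -mulr_sumr -edotE ler_piMr ?sqr_ge0//.
    by rewrite -enorm_le1.
  apply: ler_sum => i _; rewrite !mxE -expr2 -exprMn -[leRHS]real_normK ?num_real//.
  have kC1 : `|k ord0 i| <= 1 by rewrite ler_norml; exact: kC.
  rewrite ler_sqr ?nnegrE ?normr_ge0 ?le_max ?lexx ?orbT//.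
  rewrite ge_max normr_ge0 andbT lerBlDl (le_trans (ler_normD _ _))// lerD2r//.
move=> /= xl.
(* The nearest point of the cube, by clamping each coordinate. *)
pose k : 'rV[R]_n := \row_i Num.max (-1) (Num.min 1 (x ord0 i)).
have kC : cube R n k.
  by move=> i; rewrite mxE le_max lexx/= ge_max ge_min lexx andbT; lra.
have dk : edot (x - k) (x - k) = cube_sqdist x.
  rewrite edotE; apply: eq_bigr => i _; rewrite !mxE -expr2 /slab_dist.
  have [h1|/ltW h1] : 1 <= x ord0 i \/ x ord0 i < 1 by case: lerP; [left|right].
    by rewrite min_l// max_r ?ger0_norm ?max_l//; lra.
  rewrite min_r//; have [h2|/ltW h2] : x ord0 i <= -1 \/ -1 < x ord0 i by case: lerP; [left|right].
    by rewrite max_l// ler0_norm ?max_l; [ring|lra|lra].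
  rewrite max_r// subrr [in RHS]max_r ?expr0n//.
  by rewrite subr_le0 ler_norml h1 h2.
exists k => //; move: l0; rewrite le_eqVlt => /predU1P[l0|l0].
  exists 0; first by rewrite /unit_ball/= enormE edot0l sqrtr0.
  rewrite scaler0 addr0; apply/esym/eqP; rewrite -subr_eq0 -edot_eq0 eq_le edot_ge0 andbT dk.
  by move: xl; rewrite -l0 expr0n.
exists (l^-1 *: (x - k)); last first.
  by rewrite scalerA divff ?gt_eqF// scale1r addrC subrK.
rewrite /unit_ball/= enorm_le1 edotZl edotZr mulrA -expr2 exprVn mulrC.
by rewrite ler_pdivrMr ?exprn_gt0// mul1r dk.
Qed.

Lemma steiner_cube n : steiner_formula (cube R n) (fun i : 'I_n.+1 => ('C(n, i) * 2 ^ i)%N%:R).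
Proof.
move=> l l0; rewrite volE parallel_cubeE// cube_vol.
(* [cube_vol] is indexed by the dimension of the ball factor, the Steiner formula by its
   complement. *)
rewrite -sumEFin (reindex_inj rev_ord_inj)/=; apply: eq_bigr => i _.
have il : (i <= n)%N by rewrite -ltnS ltn_ord.
rewrite subSS bin_sub// subKn// ball_volE//.
by rewrite -EFinM; congr EFin; ring.
Qed.

End ball_sublevel.

Section wills_integral.
Context (R : realType) (n : nat).
Local Notation mu := (@lebesgue_measure R).

(** The layer-cake formula for $|x|^2$, whose Gaussian integral is 1. This normalisation is what
    turns each Steiner term into a bare intrinsic volume. *)
Lemma integral_kappa j :
  (\int[mu]_(l in `[0%R, +oo[) (kappa R j * l ^+ j * radial_weight l)%:E = 1)%E.
Proof.
rewrite -(integral_gaussn R j) -(layer_cake (@measurable_edot_self R j) (@edot_ge0 R j)).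
apply: eq_integral => l; rewrite inE/= in_itv/= andbT => l0.
by rewrite -/(ball_vol j _) ball_volE// EFinM.
Qed.

(** The right side does not mention [V], so all families satisfying the Steiner formula have the
    same sum; [wills_cube] passes in this way from the selected family to the explicit one. *)
Lemma wills_integral (K : set 'rV[R]_n) V : steiner_formula K V ->
  ((\sum_i V i)%:E =
   \int[mu]_(l in `[0%R, +oo[) (vol (parallel_body K l) * (radial_weight l)%:E))%E.
Proof.
move=> KV.
pose f (i : 'I_n.+1) (l : R) : \bar R :=
  (kappa R (n - i) * l ^+ (n - i) * radial_weight l)%:E.
have mf i : measurable_fun setT (f i).
  apply/measurable_EFinP; apply: measurable_funM.
    by apply: measurable_funM.
  exact: (continuous_measurable_fun (@continuous_radial_weight R)).
(* The [V i] are reals of unknown sign, so exchanging sum and integral goes through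
   integrability. *)
have intf i : mu.-integrable `[0, +oo[ (f i).
  apply/integrableP; split; first exact: (measurable_funTS (mf i)).
  under eq_integral => l.
    rewrite inE/= in_itv/= andbT => l0.
    rewrite ger0_norm; first over.
    by rewrite mulr_ge0 ?radial_weight_ge0// mulr_ge0 ?exprn_ge0// ltW ?kappa_gt0.
  by rewrite /= integral_kappa ltry.
transitivity (\int[mu]_(l in `[0%R, +oo[) \sum_(i < n.+1) (V i)%:E * f i l)%E.
  rewrite integral_sum//; last by move=> i; exact: integrableZl.
  rewrite -sumEFin; apply: eq_bigr => i _.
  by rewrite integralZl// integral_kappa mule1.
apply: eq_integral => l; rewrite inE/= in_itv/= andbT => l0.
rewrite KV// -EFinM mulr_suml -sumEFin; apply: eq_bigr => i _.
by rewrite -EFinM; congr EFin; rewrite /f; ring.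
Qed.

Lemma wills_cube : wills (cube R n) = 3 ^+ n.
Proof.
have hs := @steiner_cube R n.
have hi : steiner_formula (cube R n) (intrinsic_volume (cube R n)).
  exact: (@xgetI _ _ _ _ hs).
rewrite /wills; apply: EFin_inj; rewrite (wills_integral hi) -(wills_integral hs).
congr EFin; have -> : 3 = 1 + 2 :> R by lra.
rewrite exprDn; apply: eq_bigr => i _.
by rewrite expr1n mul1r natrM natrX mulr_natl.
Qed.

End wills_integral.

(** * Comparison of the body with its slabs *)

Section wills_le_slabs.
Context (R : realType) (n : nat) (I : finType) (c : I -> R) (u : I -> 'rV[R]_n).
Hypothesis c0 : forall i, 0 <= c i.
Hypothesis u1 : forall i, edot (u i) (u i) = 1.
Hypothesis cu : \sum_i c i *: ((u i)^T *m u i) = 1%:M.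
Variable K : set 'rV[R]_n.
Hypothesis Ku : forall x i, K x -> `|edot x (u i)| <= 1.
Local Notation mu := (@lebesgue_measure R).

Let q (x : 'rV[R]_n) := \sum_i c i * slab_dist (edot x (u i)) ^+ 2.

(** For [k] in [K], adding [l *: y] moves [edot k (u i)] away from $[-1,1]$ by at most
    [l * |edot y (u i)|]; the weighted squares of these sum to $l^2|y|^2$. *)
Lemma parallel_body_sub_slabs l : 0 <= l -> parallel_body K l `<=` [set x | q x <= l ^+ 2].
Proof.
move=> l0 x [k kK [y yB <-]] /=.
apply: (@le_trans _ _ (\sum_i l ^+ 2 * (c i * (edot y (u i) * edot y (u i))))); last first.
  by rewrite -mulr_sumr (decomposition_dot cu) ler_piMr ?sqr_ge0// -enorm_le1.
apply: ler_sum => i _; rewrite [leRHS]mulrCA ler_wpM2l// -expr2 -exprMn -[leRHS]real_normK ?num_real//.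
rewrite ler_sqr ?nnegrE ?normr_ge0 ?le_max ?lexx ?orbT//.
rewrite ge_max normr_ge0 andbT lerBlDl edotDl edotZl.
by rewrite (le_trans (ler_normD _ _))// lerD2r Ku.
Qed.

Lemma wills_le_slabs V : steiner_formula K V -> \sum_i V i <= 3 ^+ n.
Proof.
move=> KV; rewrite -lee_fin (wills_integral KV).
apply: le_trans (brascamp_lieb_slabs c0 u1 cu).
rewrite -(layer_cake (measurable_slab_sum c u)); last first.
  by move=> x; apply: sumr_ge0 => i _; rewrite mulr_ge0// sqr_ge0.
rewrite integral_mkcond [leRHS]integral_mkcond; apply: ge0_subset_integralT => l.
  rewrite patchE; case: ifPn => //; rewrite inE/= in_itv/= andbT => l0.
  by rewrite mule_ge0 ?vol_ge0// lee_fin radial_weight_ge0.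
rewrite !patchE; case: ifPn => //; rewrite inE/= in_itv/= andbT => l0.
rewrite lee_wpmul2r ?lee_fin ?radial_weight_ge0// -volE le_vol//.
exact: parallel_body_sub_slabs.
Qed.

End wills_le_slabs.

(** [xget] then returns its default, the zero family. *)
Lemma wills_default (R : realType) n (K : set 'rV[R]_n) :
  ~ (exists V, steiner_formula K V) -> wills K = 0.
Proof.
move=> noV; rewrite /wills /intrinsic_volume xgetPN; last first.
  by move=> V KV; apply: noV; exists V.
by rewrite big1.
Qed.

Lemma symmetric_contact (R : realType) n (K : set 'rV[R]_n) v x :
  symmetric_body K -> contact_cone K v -> K x -> `|edot x v| <= enorm v.
Proof.
move=> sK Kv Kx; have KNx : K (- x) by rewrite sK; exists x.
by rewrite ler_norml lerNl -edotNl !Kv.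
Qed.

Theorem theorem1p3 (R : realType) (n : nat) (K : set 'rV[R]_n)
  (hK : convex_body K) (hsym : symmetric_body K) (hJohn : john_position K) :
  wills K <= wills (cube R n).
Proof.
rewrite wills_cube.
have [[V KV]|/wills_default ->] := pselect (exists V, steiner_formula K V); last first.
  exact: exprn_ge0.
have [m [W [KW WW]]] := john_decomposition hK hJohn.
(* The weights and the unit vectors are recovered from the rows as squared norms and directions;
   zero rows have no direction and add nothing to [W^T *m W]. *)
pose I := {i : 'I_m | row i W != 0}.
have v0 (i : I) : 0 < enorm (row (val i) W) by apply: enorm_gt0; exact: (valP i).
pose c (i : I) := edot (row (val i) W) (row (val i) W).
pose u (i : I) := (enorm (row (val i) W))^-1 *: row (val i) W.
have vv (i : I) : c i = enorm (row (val i) W) ^+ 2 by rewrite enorm_sqr.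
apply: (@wills_le_slabs R n I c u _ _ _ K).
- by move=> i; exact: edot_ge0.
- by move=> i; rewrite edotZl edotZr -/(c i) vv; field; rewrite gt_eqF.
- rewrite -WW; apply/matrixP => a b; rewrite summxE !mxE.
  rewrite [RHS](bigID (fun i => row i W != 0))/= [X in _ + X]big1 ?addr0; last first.
    by move=> i /negPn/eqP/rowP/(_ a); rewrite !mxE => ->; rewrite mul0r.
  rewrite [RHS](reindex_omap (val : I -> 'I_m) insub)/=; last first.
    by move=> i vi; rewrite insubT.
  apply: eq_big => [i|i _]; first by rewrite (valP i) valK eqxx.
  rewrite !mxE big_ord1 !mxE vv; field; rewrite gt_eqF//.
- move=> x i Kx; rewrite edotZr normrM ger0_norm ?invr_ge0 ?enorm_ge0//.
  by rewrite mulrC ler_pdivrMr// mul1r (symmetric_contact hsym (KW _)).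
- exact: (@xgetI _ _ _ _ KV).
Qed.
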